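(* Let $\mathbb{G}$ be a stratified Lie group of homogeneous dimension $Q$. Let $0<\beta<1$, $0<\alpha<\alpha+\beta<Q$, and let $b$ be a locally integrable function on $\mathbb{G}$. Then the following statements are equivalent: (B.1) $b\in\Lambda_{\beta}(\mathbb{G})$. (B.2) $M_{\alpha,b}$ is bounded from $L^{p}(\mathbb{G})$ to $L^{q}(\mathbb{G})$ for all $p,q$ with $1<p<\frac{Q}{\alpha+\beta}$ and $\frac1q=\frac1p-\frac{\alpha+\beta}{Q}$. (B.3) $M_{\alpha,b}$ is bounded from $L^{p}(\mathbb{G})$ to $L^{q}(\mathbb{G})$ for some $p,q$ with $1<p<\frac{Q}{\alpha+\beta}$ and $\frac1q=\frac1p-\frac{\alpha+\beta}{Q}$. (B.4) There exists $s\in[1,\infty)$ such that $$\sup_{B}\frac{1}{|B|^{\beta/Q}}\left(\frac{1}{|B|}\int_{B}|b(x)-b_{B}|^{s}dx\right)^{1/s}<\infty,$$ where the supremum is taken over all $\mathbb{G}$-balls $B\subset\mathbb{G}$. (B.5) For all $s\in[1,\infty)$, $$\sup_{B}\frac{1}{|B|^{\beta/Q}}\left(\frac{1}{|B|}\int_{B}|b(x)-b_{B}|^{s}dx\right)^{1/s}<\infty,$$ where the supremum is taken over all $\mathbb{G}$-balls $B\subset\mathbb{G}$.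
   Context: Stratified Lie group: $\mathbb{G}$ is a finite-dimensional, connected and simply connected Lie group whose Lie algebra $\mathcal{G}$ has a vector space decomposition $\mathcal{G}=V_1\oplus\cdots\oplus V_m$ with $[V_1,V_j]=V_{j+1}$ for $1\le j\le m-1$ and $[V_1,V_j]=0$ for $j\ge m$; $\mathcal{G}$ is nilpotent of step $m$. The dilations $\delta_r$ ($r>0$) are defined on $\mathcal{G}$ by $\delta_r(\sum_k X_k)=\sum_k r^kX_k$ for $X_k\in V_k$, and are transported to $\mathbb{G}$ by the exponential map (a diffeomorphism). The homogeneous dimension is $Q=\sum_{j=1}^m j\dim V_j$. Integration $dx$ and $|\cdot|$ refer to a fixed bi-invariant Haar measure on $\mathbb{G}$, and $L^p(\mathbb{G})$ is the usual Lebesgue space for it. The identity element is $e$. Fix a homogeneous norm $\rho:\mathbb{G}\to[0,\infty)$: a continuous function, $C^\infty$ away from $e$, with $\rho(x^{-1})=\rho(x)$, $\rho(\delta_t x)=t\rho(x)$ for $t>0$, $\rho(e)=0$, and $\rho(xy)\le c_0(\rho(x)+\rho(y))$ for some constant $c_0\ge1$. The $\mathbb{G}$-balls are $B(x,r)=\{y\in\mathbb{G}:\rho(y^{-1}x)<r\}$, $x\in\mathbb{G}$, $r>0$; there is a constant $c_1\in(0,\infty)$ with $|B(x,r)|=c_1r^Q$ for all $x$ and $r$. Functions are real-valued, and locally integrable functions that agree almost everywhere are identified. For $0<\beta<1$, $b\in\Lambda_\beta(\mathbb{G})$ means that there is $C>0$ with $|b(x)-b(y)|\le C(\rho(y^{-1}x))^\beta$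 for all $x,y\in\mathbb{G}$. For a ball $B$, $b_B=\frac{1}{|B|}\int_B b(x)\,dx$. For $0\le\alpha<Q$ the maximal commutator is $M_{\alpha,b}(f)(x)=\sup_{B\ni x}\frac{1}{|B|^{1-\alpha/Q}}\int_B|b(x)-b(y)||f(y)|\,dy$, the supremum being over all $\mathbb{G}$-balls $B\subset\mathbb{G}$ containing $x$. An operator $T$ is bounded from $L^p(\mathbb{G})$ to $L^q(\mathbb{G})$ if there is $C>0$ with $\|T f\|_{L^q(\mathbb{G})}\le C\|f\|_{L^p(\mathbb{G})}$ for all $f\in L^p(\mathbb{G})$ (no linearity is assumed). *)

(* Defs.v *)
From HB Require Import structures.
From mathcomp Require Import all_boot all_order all_algebra.
From mathcomp Require Import all_classical all_reals all_analysis.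

Set Implicit Arguments.
Unset Strict Implicit.
Unset Printing Implicit Defensive.

Import Order.TTheory GRing.Theory Num.Theory.
Import numFieldNormedType.Exports.

Local Open Scope classical_set_scope.
Local Open Scope ring_scope.

(** * Smooth maps between normed spaces *)

Section Smooth.
Context {R : realType} {V W : normedModType R}.

Definition iter_derive (vs : seq V) (f : V -> W) : V -> W :=
  foldr (fun v g x => 'D_v g x) f vs.

(* For an open [U] this is C^oo on [U]: all iterated directional derivatives
   exist and are (Frechet) differentiable, hence continuous, on [U]. *)
Definition smooth_on (U : set V) (f : V -> W) : Prop :=
  forall vs x, U x -> differentiable (iter_derive vs f) x.

End Smooth.

(** * Lie groups *)

(* The base point coming with [PointedTopological] plays no role; it is there
   because the library only puts sigma-algebras on pointed types. *)
HB.mixin Record isTopologicalGroup G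
    of PointedTopological G & Group G := {
  mulg_continuous : continuous (fun x : G * G => (x.1 * x.2)%g);
  invg_continuous : continuous (fun x : G => (x^-1)%g)
}.

#[short(type="topologicalGroupType")]
HB.structure Definition TopologicalGroup :=
  {G of PointedTopological G & Group G & isTopologicalGroup G}.

Section Manifold.
Context {R : realType} {n : nat} {G : topologicalGroupType}.

(* [cinv] is only meaningful on the image [cimg] of the chart. *)
Record chart := Chart {
  cdom : set G;
  cmap : G -> 'rV[R]_n;
  cinv : 'rV[R]_n -> G
}.

Definition cimg (c : chart) : set 'rV[R]_n := cmap c @` cdom c.

Record is_chart (c : chart) : Prop := IsChart {
  cdom_open : open (cdom c);
  cimg_open : open (cimg c);
  cmapK : forall x, cdom c x -> cinv c (cmap c x) = x;
  cmap_continuous : {within cdom c, continuous (cmap c)};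
  cinv_continuous : {within cimg c, continuous (cinv c)}
}.

Record smooth_atlas (A : set chart) : Prop := SmoothAtlas {
  atlas_chart : forall c, A c -> is_chart c;
  atlas_cover : forall x, exists2 c, A c & cdom c x;
  atlas_compat : forall c d, A c -> A d ->
    smooth_on (cmap c @` (cdom c `&` cdom d)) (cmap d \o cinv c)
}.

(* The continuity of multiplication and inversion, part of [G], makes the sets
   below open. *)
Record is_lie_group (A : set chart) : Prop := IsLieGroup {
  lie_hausdorff : hausdorff_space G;
  lie_second_countable : @second_countable G;
  lie_atlas : smooth_atlas A;
  lie_mul_smooth : forall c d k, A c -> A d -> A k ->
    smooth_on
      [set u : 'rV[R]_n * 'rV[R]_n | [/\ cimg c u.1, cimg d u.2 &
        cdom k (cinv c u.1 * cinv d u.2)%g]]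
      (fun u => cmap k (cinv c u.1 * cinv d u.2)%g);
  lie_inv_smooth : forall c k, A c -> A k ->
    smooth_on [set u | cimg c u /\ cdom k (cinv c u)^-1%g]
      (fun u => cmap k (cinv c u)^-1%g)
}.

Variable A : set chart.

Definition smooth_fun_on (U : set G) (f : G -> R) : Prop :=
  forall c, A c -> smooth_on (cmap c @` (cdom c `&` U)) (f \o cinv c : _ -> R^o).

Definition smooth_fun (f : G -> R) : Prop := smooth_fun_on setT f.

(** Left-invariant vector fields, as derivations of C^oo(G) commuting with left
    translations. Only the values on smooth functions matter. *)
Record left_invariant_field (X : (G -> R) -> (G -> R)) : Prop :=
  LeftInvariantField {
  field_smooth : forall f, smooth_fun f -> smooth_fun (X f);
  field_linear : forall (a : R) f g, smooth_fun f -> smooth_fun g ->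
    X (fun x => a * f x + g x) = (fun x => a * X f x + X g x);
  field_leibniz : forall f g, smooth_fun f -> smooth_fun g ->
    X (fun x => f x * g x) = (fun x => f x * X g x + g x * X f x);
  field_left_invariant : forall (a : G) f, smooth_fun f ->
    X (fun x => f (a * x)%g) = (fun x => X f (a * x)%g)
}.

(** [D] identifies R^n, through the choice of a basis, with the Lie algebra of
    left-invariant vector fields on [G], the bracket [br] corresponding to the
    commutator of vector fields. *)
Record is_lie_algebra (D : 'rV[R]_n -> (G -> R) -> (G -> R))
    (br : 'rV[R]_n -> 'rV[R]_n -> 'rV[R]_n) : Prop := IsLieAlgebra {
  alg_field : forall v, left_invariant_field (D v);
  alg_linear : forall (a : R) v w f, smooth_fun f ->
    D (a *: v + w) f = (fun x => a * D v f x + D w f x);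
  alg_inj : forall v,
    (forall f, smooth_fun f -> D v f = (fun=> 0)) -> v = 0;
  alg_surj : forall X, left_invariant_field X ->
    exists v, forall f, smooth_fun f -> D v f = X f;
  alg_bracket : forall v w f, smooth_fun f ->
    D (br v w) f = (fun x => D v (D w f) x - D w (D v f) x)
}.

(** [t |-> expG (t v)] is the integral curve through the identity of the vector
    field [D v]. *)
Definition is_exponential (D : 'rV[R]_n -> (G -> R) -> (G -> R))
    (expG : 'rV[R]_n -> G) : Prop :=
  expG 0 = 1%g /\
  forall v f (t : R), smooth_fun f ->
    is_derive t 1 (fun s : R => f (expG (s *: v))) (D v f (expG (t *: v))).

Record is_diffeo (expG : 'rV[R]_n -> G) (logG : G -> 'rV[R]_n) : Prop :=
  IsDiffeo {
  diffeo_expK : cancel expG logG;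
  diffeo_logK : cancel logG expG;
  diffeo_exp_continuous : continuous expG;
  diffeo_log_continuous : continuous logG;
  diffeo_exp_smooth : forall c, A c ->
    smooth_on (expG @^-1` cdom c) (cmap c \o expG);
  diffeo_log_smooth : forall c, A c -> smooth_on (cimg c) (logG \o cinv c)
}.

End Manifold.

Arguments chart : clear implicits.

Definition simply_connected (R : realType) (G : topologicalType) : Prop :=
  connected [set: G] /\
  forall g : R -> G, {within `[0, 1], continuous g} -> g 0 = g 1 ->
  exists2 H : R * R -> G,
    {within `[0, 1]%classic `*` `[0, 1]%classic, continuous H} &
    forall t : R, 0 <= t <= 1 ->
      [/\ H (0, t) = g t, H (1, t) = g 0, H (t, 0) = g 0 & H (t, 1) = g 0].

(** * Stratified Lie groups *)

Section Stratification.
Context {R : realType} {n : nat}.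
Variable br : 'rV[R]_n -> 'rV[R]_n -> 'rV[R]_n.

(** [Z] is the linear span of the brackets [br u w], [u] in [U], [w] in [W]. *)
Definition is_bracket (U W Z : {vspace 'rV[R]_n}) : Prop :=
  (forall u w, u \in U -> w \in W -> br u w \in Z) /\
  forall Z' : {vspace 'rV[R]_n},
    (forall u w, u \in U -> w \in W -> br u w \in Z') -> (Z <= Z')%VS.

(* Only [V 1], ..., [V m] matter. As [V m != 0], the step is exactly [m]. *)
Record is_stratification (m : nat) (V : nat -> {vspace 'rV[R]_n}) : Prop :=
  IsStratification {
  strat_full : (\sum_(i < m) V i.+1 = fullv)%VS;
  strat_direct : directv (\sum_(i < m) V i.+1)%VS;
  strat_bracket : forall j, (1 <= j < m)%N -> is_bracket (V 1%N) (V j) (V j.+1);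
  strat_last : is_bracket (V 1%N) (V m) 0%VS;
  strat_step : (0 < m)%N /\ V m != 0%VS
}.

Definition dilation_alg (m : nat) (V : nat -> {vspace 'rV[R]_n}) (r : R)
    (X : 'rV[R]_n) : 'rV[R]_n :=
  \sum_(i < m) r ^+ i.+1 *: sumv_pi (\sum_(i < m) V i.+1)%VS i X.

End Stratification.

(* [sg_diffeo] is automatic for a connected, simply connected, nilpotent Lie
   group; it is recorded because [sg_log] is needed to define dilations. *)
Record stratifiedGroup (R : realType) := StratifiedGroup {
  sg_group :> topologicalGroupType;
  sg_dim : nat;
  sg_atlas : set (chart R sg_dim sg_group);
  sg_lie : is_lie_group sg_atlas;
  sg_simply_connected : simply_connected R sg_group;
  sg_field : 'rV[R]_sg_dim -> (sg_group -> R) -> (sg_group -> R);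
  sg_bracket : 'rV[R]_sg_dim -> 'rV[R]_sg_dim -> 'rV[R]_sg_dim;
  sg_algebra : is_lie_algebra sg_atlas sg_field sg_bracket;
  sg_exp : 'rV[R]_sg_dim -> sg_group;
  sg_log : sg_group -> 'rV[R]_sg_dim;
  sg_exponential : is_exponential sg_atlas sg_field sg_exp;
  sg_diffeo : is_diffeo sg_atlas sg_exp sg_log;
  sg_step : nat;
  sg_layer : nat -> {vspace 'rV[R]_sg_dim};
  sg_stratification : is_stratification sg_bracket sg_step sg_layer
}.

Notation borel G := (g_sigma_algebraType (@open G)).

Section StratifiedGroupTheory.
Context {R : realType} (G : stratifiedGroup R).

Definition dilation (r : R) (x : G) : G :=
  sg_exp (dilation_alg (sg_step G) (sg_layer G) r (sg_log x)).

Definition hom_dim : nat :=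
  (\sum_(j < sg_step G) j.+1 * \dim (sg_layer G j.+1))%N.

Record homogeneous_norm (rho : G -> R) : Prop := HomogeneousNorm {
  hnorm_ge0 : forall x, 0 <= rho x;
  hnorm_continuous : continuous rho;
  hnorm_smooth : smooth_fun_on (@sg_atlas R G) (~` [set 1%g]) rho;
  hnorm_inv : forall x, rho (x^-1)%g = rho x;
  hnorm_dilation : forall t x, 0 < t -> rho (dilation t x) = t * rho x;
  hnorm1 : rho 1%g = 0;
  hnorm_quasi_triangle : exists2 c0 : R, 1 <= c0 &
    forall x y, rho (x * y)%g <= c0 * (rho x + rho y)
}.

Record bi_invariant_haar (mu : {measure set (borel G) -> \bar R}) : Prop :=
  BiInvariantHaar {
  haar_compact : forall K : set G, compact K -> (mu K < +oo)%E;
  haar_open : forall U : set G, open U -> U !=set0 -> (0 < mu U)%E;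
  haar_left : forall (a : G) (E : set (borel G)), measurable E ->
    mu [set (a * x)%g | x in (E : set G)] = mu E;
  haar_right : forall (a : G) (E : set (borel G)), measurable E ->
    mu [set (x * a)%g | x in (E : set G)] = mu E
}.

Variables (rho : G -> R) (mu : {measure set (borel G) -> \bar R}).

Definition gball (x : G) (r : R) : set G := [set y | rho (y^-1 * x)%g < r].

Definition gballs : set (set G) :=
  [set B | exists x r, 0 < r /\ B = gball x r].

(** |B(x, r)| = c1 r^Q *)
Definition ball_volume : Prop :=
  exists2 c1 : R, 0 < c1 &
    forall x r, 0 < r -> mu (gball x r) = (c1 * r ^+ hom_dim)%:E.

(* Every class of a.e. equal locally integrable functions contains a Borel
   function, so Borel measurability is not a restriction. *)
Definition loc_integrable (b : G -> R) : Prop :=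
  measurable_fun [set: borel G] (b : borel G -> R) /\
  forall K : set G, compact K -> mu.-integrable K (EFin \o b).

Definition lipschitz (beta : R) (b : G -> R) : Prop :=
  exists2 C : R, 0 < C &
    forall x y, `|b x - b y| <= C * (rho (y^-1 * x)%g) `^ beta.

(** [b] belongs to the Lipschitz space as a class of a.e. equal functions. *)
Definition in_lipschitz (beta : R) (b : G -> R) : Prop :=
  exists2 b' : G -> R, lipschitz beta b' &
    {ae mu, forall x, b x = b' x}.

Definition vol (B : set G) : R := fine (mu B).

Definition mean (b : G -> R) (B : set G) : R :=
  (vol B)^-1 * \int[mu]_(x in B) b x.

Local Open Scope ereal_scope.

Definition maximal_commutator (alpha : R) (b f : G -> R) (x : G) : \bar R :=
  ereal_sup [set ((vol B `^ (1 - alpha / hom_dim%:R))^-1)%:E *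
                 \int[mu]_(y in B) (`|b x - b y| * `|f y|)%:E
            | B in [set B | gballs B /\ B x]].

Definition bounded_Lp_Lq (p q : R) (T : (G -> R) -> G -> \bar R) : Prop :=
  exists2 C : R, (0 < C)%R &
    forall f : borel G -> R, f \in Lfun mu p%:E ->
      'N[mu]_(q%:E)[(T f : borel G -> \bar R)] <= C%:E * 'N[mu]_(p%:E)[EFin \o f].

Definition campanato_finite (beta s : R) (b : G -> R) : Prop :=
  ereal_sup [set ((vol B `^ (beta / hom_dim%:R))^-1)%:E *
                 (((vol B)^-1)%:E *
                  \int[mu]_(x in B) (`|b x - mean b B| `^ s)%:E) `^ (s^-1)
            | B in gballs] < +oo.

End StratifiedGroupTheory.

(* Main.v *)
Require Import Defs.
From HB Require Import structures.
From mathcomp Require Import all_boot all_order all_algebra.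
From mathcomp Require Import all_classical all_reals all_analysis.
From mathcomp Require Import measurable_realfun ring lra.

Set Implicit Arguments.
Unset Strict Implicit.
Unset Printing Implicit Defensive.

Import Order.TTheory GRing.Theory Num.Theory.
Import numFieldNormedType.Exports.

Local Open Scope classical_set_scope.
Local Open Scope ring_scope.

(** The group enters only through the quasi-distance rho(y^-1 x), for which the
    Haar measure is Ahlfors regular: a ball of radius r has measure c1 r^Q.
    Almost all of the proof takes place in an abstract space with this property
    ([ahlfors_regular]). From the group come two topological facts: there is a
    dense sequence ([gdist_dense]), and balls are relatively compact
    ([gball_relatively_compact]), so that locally integrable functions are
    integrable on balls.

    A Lipschitz b gives a bounded commutator ([commutator_Lp_Lq]). On a ball of
    radius r one has |b(x) - b(y)| <= C r^beta, so the commutator of f is at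
    most a constant times the fractional maximal function
    sup |B|^((alpha + beta)/Q - 1) int_B |f|. With t = p (alpha + beta)/Q < 1,
    the quantity under the supremum is the (1-t)-th power of the mean of |f| on
    B times the t-th power of |B|^(1/p - 1) int_B |f|, and Hoelder's inequality
    bounds the latter integral by the L^p norm of f
    ([hedberg_interpolation]). Since (1-t) q = p, the claim reduces to the
    boundedness on L^p of the Hardy-Littlewood maximal function
    ([maximal_function]), which follows from the Vitali covering lemma and a
    dyadic decomposition of the levels ([strong_of_weak]).

    A bounded commutator gives finite mean oscillation with exponent s = q
    ([commutator_campanato]). For f the indicator of B and x in B, the
    commutator at x is at least |B|^(alpha/Q) times the mean over y in B of
    |b(x) - b(y)|, hence at least |B|^(alpha/Q) |b(x) - b_B|.

    Finite mean oscillation for one s gives a Lipschitz representative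
    ([lipschitz_representative]). The elementary t <= 1 + t^s reduces to the
    exponent 1 ([campanato_osc]). The means of b on two nested balls of
    comparable radii then differ by O(r^beta) ([mean_nested]), so the means on
    B(x, r) converge as r tends to 0 to a limit b'(x), within O(r^beta), and
    b' is Lipschitz. That b' = b almost everywhere needs no differentiation
    theorem: the integral of |b - b'| over any ball of radius e is
    O(e^beta) |B|, and a fixed ball is covered by O(e^-Q) balls of radius e, so
    the integral of |b - b'| over the fixed ball is O(e^beta) for all e.

    Conversely a Lipschitz function has finite mean oscillation for all s
    ([lipschitz_campanato]), which closes the cycle.

    The commutator of f is not shown to be measurable. The integral of a
    nonnegative function is the supremum of the integrals of the simple
    functions below it, and the comparisons above only use a measurable function
    on one side ([le_integral_pointwise], [le_integral_ae]). *)

(** * Coverings in Ahlfors regular quasi-metric spaces *)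

Section RegularSpace.
Context d (T : measurableType d) (R : realType).
Variables (mu : {measure set T -> \bar R}) (dist : T -> T -> R).
Variables (Q : nat) (c0 c1 : R).

Definition qball (x : T) (r : R) : set T := [set y | dist x y < r].

Record ahlfors_regular : Prop := AhlforsRegular {
  dist_ge0 : forall x y, 0 <= dist x y;
  distxx : forall x, dist x x = 0;
  dist_sym : forall x y, dist x y = dist y x;
  quasi_ge1 : 1 <= c0;
  dist_tri : forall x y z, dist x z <= c0 * (dist x y + dist y z);
  volume_gt0 : 0 < c1;
  regular_dim_gt0 : (0 < Q)%N;
  measurable_qball : forall x r, measurable (qball x r);
  measure_qball : forall x r, 0 < r -> mu (qball x r) = (c1 * r ^+ Q)%:E
}.

Hypothesis reg : ahlfors_regular.

Let c0_gt0 : 0 < c0. Proof. exact: lt_le_trans ltr01 (quasi_ge1 reg). Qed.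

Lemma qball_tri x y z r t : dist x y < r -> dist y z < t ->
  dist x z < c0 * (r + t).
Proof.
move=> xy yz; apply: le_lt_trans (dist_tri reg x y z) _.
by rewrite ltr_pM2l// ltrD.
Qed.

Lemma qball_center x r : 0 < r -> qball x r x.
Proof. by move=> r0; rewrite /qball/= (distxx reg). Qed.

(** The constant comes from using the quasi-triangle inequality twice:
    c0 (t + c0 (r + r)) <= 3 c0^2 t, as r <= t and 1 <= c0. *)
Lemma meet_qball_sub x r y t : r <= t -> qball x r `&` qball y t !=set0 ->
  qball x r `<=` qball y (3 * c0 ^+ 2 * t).
Proof.
move=> rt [w [xw yw]] u xu; rewrite /qball/=.
have wx : dist w x < r by rewrite (dist_sym reg).
have := qball_tri yw (qball_tri wx xu).
move/lt_le_trans; apply; have c01 := quasi_ge1 reg.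
have t0 : 0 < t by apply: le_lt_trans yw; exact: dist_ge0 reg _ _.
have -> : 3 * c0 ^+ 2 * t = c0 * (c0 * t + c0 * (t + t)) by ring.
rewrite ler_pM2l// lerD//.
  by rewrite ler_peMl // ltW.
by rewrite ler_pM2l// lerD.
Qed.

(** The balls are considered from the largest to the smallest, and a ball is
    selected when it is disjoint from those selected so far; a rejected ball
    meets a selected one of larger radius. *)
Lemma vitali_sorted (s : seq (T * R)) :
  sorted (fun i j : T * R => i.2 <= j.2) s ->
  exists t : seq (T * R), [/\ uniq t, {subset t <= s},
    trivIset [set` t] (fun i => qball i.1 i.2) &
    forall i, i \in s -> 0 < i.2 -> exists2 j, j \in t &
      qball i.1 i.2 `<=` qball j.1 (3 * c0 ^+ 2 * j.2)].
Proof.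
elim: s => [_|a s IH sas]; first by exists [::]; split => //= i j; rewrite in_nil.
have [t [ut ts tt st]] := IH (path_sorted sas).
have as_ i : i \in s -> a.2 <= i.2.
  have /allP := order_path_min (fun _ _ _ => @le_trans _ _ _ _ _) sas.
  exact.
have c01 : 1 <= 3 * c0 ^+ 2.
  have : 1 <= c0 ^+ 2 by rewrite exprn_ege1// (quasi_ge1 reg).
  lra.
have [[j jt aj]|aN] := pselect
    (exists2 j, j \in t & qball a.1 a.2 `&` qball j.1 j.2 !=set0).
  exists t; split => //; first by move=> i it; rewrite in_cons ts// orbT.
  move=> i; rewrite in_cons => /orP[/eqP -> _|is_ i0]; last exact: st.
  by exists j => //; apply: meet_qball_sub => //; apply/as_/ts.
have [a20|a20] := leP a.2 0.
  exists t; split => //; first by move=> i it; rewrite in_cons ts// orbT.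
  move=> i; rewrite in_cons => /orP[/eqP ->|is_ i0]; last exact: st.
  by rewrite ltNge a20.
exists (a :: t); split => /=.
- rewrite ut andbT; apply/negP => at_; apply: aN; exists a => //.
  by exists a.1; split; exact: qball_center.
- move=> i; rewrite !in_cons => /orP[->//|/ts ->]; exact: orbT.
- move=> i j /=; rewrite !in_cons.
  move=> /orP[/eqP->|it] /orP[/eqP->|jt]//.
  + by move=> h; exfalso; apply: aN; exists j.
  + by move=> h; exfalso; apply: aN; exists i => //; rewrite setIC.
  + exact: tt.
- move=> i; rewrite in_cons => /orP[/eqP -> _|is_ i0].
    exists a; rewrite ?mem_head// => y /lt_le_trans; apply.
    by rewrite ler_peMl// ltW.
  by have [j jt ij] := st _ is_ i0; exists j => //; rewrite in_cons jt orbT.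
Qed.

Lemma vitali_finite (s : seq (T * R)) :
  exists t : seq (T * R), [/\ uniq t, {subset t <= s},
    trivIset [set` t] (fun i => qball i.1 i.2) &
    forall i, i \in s -> 0 < i.2 -> exists2 j, j \in t &
      qball i.1 i.2 `<=` qball j.1 (3 * c0 ^+ 2 * j.2)].
Proof.
have [|t [ut ts tt st]] := @vitali_sorted (sort (fun i j : T * R => i.2 <= j.2) s).
  by apply: sort_sorted => i j; exact: le_total.
exists t; split => // [i /ts|i is_]; first by rewrite mem_sort.
by apply: st; rewrite mem_sort.
Qed.

Lemma measure_disjoint_seq (W : T -> set T) (s : seq T) (w : R) (B : set T) :
  uniq s -> trivIset [set` s] W -> measurable B ->
  (forall x, x \in s -> [/\ measurable (W x), (w%:E <= mu (W x))%E & W x `<=` B]) ->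
  (((size s)%:R * w)%:E <= mu B)%E.
Proof.
move=> us ts mB sW.
suff : (((size s)%:R * w)%:E <= mu (B `&` \bigcup_(x in [set` s]) W x))%E.
  move/le_trans; apply; apply: le_measure; rewrite ?inE//.
  apply: measurableI => //; rewrite bigcup_seq.
  by rewrite big_seq; apply: bigsetU_measurable => x /sW[].
elim: s us ts sW => [|a s IH] /=.
  by move=> _ _ _; rewrite mul0r measure_ge0.
move=> /andP[as_ us] ts sW.
have ms : measurable (\bigcup_(x in [set` s]) W x).
  rewrite bigcup_seq big_seq; apply: bigsetU_measurable => x xs.
  by have [] := sW x _; rewrite // in_cons xs orbT.
have [mWa wWa WaB] := sW a (mem_head _ _).
have -> : B `&` \bigcup_(x in [set` a :: s]) W x =
    W a `|` (B `&` \bigcup_(x in [set` s]) W x).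
  rewrite !bigcup_seq big_cons setIUr; congr (_ `|` _).
  by rewrite setIC; exact: setIidl.
rewrite measureU//; last 2 first.
- exact: measurableI.
- apply/seteqP; split => // x [Wax [_ [y ys Wyx]]].
  have : a = y by apply: ts; rewrite /= ?mem_head ?in_cons ?ys ?orbT//; exists x.
  by move=> ay; move: as_; rewrite ay ys.
rewrite -natr1 mulrDl mul1r EFinD addeC leeD//; apply: IH => //.
- by apply: sub_trivIset ts => x /= xs; rewrite in_cons xs orbT.
- by move=> x xs; apply: sW; rewrite in_cons xs orbT.
Qed.

(** A family of disjoint sets W x, each of measure at least w, inside a set of
    measure v has at most v / w members, so there is one with as many members
    as possible; by maximality every other W x meets one of its members. *)
Lemma maximal_packing (A B : set T) (W : T -> set T) (w v : R) :
  0 < w -> measurable B -> mu B = v%:E ->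
  (forall x, A x -> [/\ measurable (W x), (w%:E <= mu (W x))%E & W x `<=` B]) ->
  exists s : seq T, [/\ forall x, x \in s -> A x, (size s)%:R * w <= v &
    forall x, A x -> exists2 y, y \in s & W x `&` W y !=set0].
Proof.
move=> w0 mB Bv AW.
pose P n := exists s : seq T, [/\ size s = n, uniq s,
  forall x, x \in s -> A x & trivIset [set` s] W].
have Psize s : uniq s -> (forall x, x \in s -> A x) -> trivIset [set` s] W ->
    (size s)%:R * w <= v.
  move=> us sA ts; rewrite -lee_fin -Bv.
  by apply: (measure_disjoint_seq us ts) => // x /sA; exact: AW.
have [|n Pn|n /asboolP[s [sn us sA ts]] nmax] :=
  @ex_maxnP (fun n => `[< P n >]) (Num.trunc (v / w)).
- exists 0%N; apply/asboolP; exists [::]; split => //.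
- move/asboolP : Pn => [s [<- us sA ts]].
  have v0 : 0 <= v by rewrite -lee_fin -Bv measure_ge0.
  by rewrite truncn_ge_nat ?divr_ge0 ?(ltW w0)// ler_pdivlMr// Psize.
exists s; split => //; first exact: Psize.
move=> x Ax; apply: contrapT => xN.
have [mWx wWx WxB] := AW _ Ax.
have xx : W x `&` W x !=set0.
  rewrite setIid; apply/set0P/eqP => Wx0; move: wWx.
  by rewrite Wx0 measure0 lee_fin leNgt w0.
have xs : x \notin s by apply/negP => xs; apply: xN; exists x.
suff /nmax : `[< P n.+1 >] by rewrite ltnn.
apply/asboolP; exists (x :: s); split => /=.
- by rewrite sn.
- by rewrite xs us.
- by move=> y; rewrite in_cons => /orP[/eqP->//|/sA].
- move=> i j /=; rewrite !in_cons => /orP[/eqP->|it] /orP[/eqP->|jt]//.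
  + by move=> h; exfalso; apply: xN; exists j.
  + by move=> h; exfalso; apply: xN; exists i => //; rewrite setIC.
  + exact: ts.
Qed.

(** Centres of a maximal family of disjoint balls of radius e / (2 c0): two
    such balls that meet have centres at distance less than e, and the volume
    bounds their number. *)
Lemma cover_qball z r e : 0 < e <= r -> exists s : seq T,
  (size s)%:R * e ^+ Q <= (4 * c0 ^+ 2 * r) ^+ Q /\
  qball z r `<=` \bigcup_(x in [set` s]) qball x e.
Proof.
move=> /andP[e0 er]; have r0 := lt_le_trans e0 er.
have c01 := quasi_ge1 reg.
pose h := e / (2 * c0).
have h0 : 0 < h by rewrite divr_gt0// mulr_gt0.
have hr : h <= r.
  apply: le_trans er; rewrite ler_pdivrMr ?mulr_gt0// ler_peMr ?(ltW e0)//.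
  by lra.
have [|||x zx|s [sz ss sc]] := @maximal_packing (qball z r)
  (qball z (2 * c0 * r)) (fun x => qball x h) (c1 * h ^+ Q) (c1 * (2 * c0 * r) ^+ Q).
- by rewrite mulr_gt0 ?exprn_gt0// volume_gt0.
- exact: measurable_qball.
- by rewrite (measure_qball reg)// !mulr_gt0.
- split; [exact: measurable_qball|by rewrite (measure_qball reg)|].
  move=> y xy; apply: lt_le_trans (qball_tri zx xy) _.
  by rewrite (mulrC 2) -mulrA ler_pM2l// mulr_natl mulr2n lerD2l.
exists s; split.
  move: ss; rewrite mulrCA ler_pM2l ?(volume_gt0 reg)//.
  rewrite /h expr_div_n mulrA ler_pdivrMr ?exprn_gt0 ?mulr_gt0//.
  by rewrite -exprMn; congr (_ <= _ ^+ _); ring.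
move=> x /sc[y ys [w [xw yw]]]; exists y => //.
have wx : dist w x < h by rewrite (dist_sym reg).
apply: lt_le_trans (qball_tri yw wx) _.
suff -> : c0 * (h + h) = e by [].
by rewrite /h; field; rewrite gt_eqF.
Qed.

End RegularSpace.

(** * From a weak-type inequality to an L^p inequality *)

Section LayerCake.
Context d (T : measurableType d) (R : realType).
Variable (mu : {measure set T -> \bar R}).

Lemma measurable_superlevel (g : T -> R) (l : R) : measurable_fun setT g ->
  measurable [set x | l < g x].
Proof.
move=> mg; rewrite -[X in measurable X]setTI.
apply: (@measurable_fun_ltr _ _ _ setT (cst l) g) => //.
Qed.

Lemma measurable_level_band (h : T -> R) (a c : R) : measurable_fun setT h ->
  measurable [set x | a < h x <= c].
Proof.
move=> mh; rewrite (_ : [set _ | _] = [set x | a < h x] `&`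
    ~` [set x | c < h x]); last first.
  apply/seteqP; split => x /=.
    by move=> /andP[-> xc]; split => //; apply/negP; rewrite -leNgt.
  by move=> [-> /negP]; rewrite -leNgt => ->.
by apply: measurableI; [|apply: measurableC]; exact: measurable_superlevel.
Qed.

Lemma pow2N_lt1 (e : R) : 0 < e -> 2 `^ (- e) < 1 :> R.
Proof.
move=> e0; rewrite powRN invf_lt1 ?powR_gt0//.
suff : 1 `^ e < 2 `^ e :> R by rewrite powR1.
by rewrite gt0_ltr_powR ?nnegrE ?ler0n ?ltr1n.
Qed.

(** The e-th powers of the levels s 2^k below a form a geometric progression,
    dominated by its largest term. *)
Lemma geometric_levels (e a s : R) n : 0 < e -> 0 < s -> 0 <= a ->
  \sum_(k < n) (s * 2 ^+ k) `^ e * (s * 2 ^+ k < a)%R%:R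
    <= a `^ e / (1 - 2 `^ (- e)).
Proof.
move=> e0 s0 a0; set u := 2 `^ (- e).
have u1 : u < 1 by exact: pow2N_lt1.
have u0 : 0 < u by rewrite powR_gt0.
have w0 : 0 < 1 - u by rewrite subr_gt0.
have step m : (s * 2 ^+ m) `^ e = u * (s * 2 ^+ m.+1) `^ e.
  have sm0 : 0 <= s * 2 ^+ m by rewrite mulr_ge0 ?ltW// exprn_gt0.
  rewrite exprS (mulrCA s) [in RHS]powRM//.
  by rewrite mulrA /u powRN mulVf ?mul1r// gt_eqF ?powR_gt0.
have full m : \sum_(k < m) (s * 2 ^+ k) `^ e <= u * (s * 2 ^+ m) `^ e / (1 - u).
  elim: m => [|m IH].
    by rewrite big_ord0 !mulr_ge0 ?powR_ge0 ?invr_ge0 ?ltW.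
  rewrite big_ord_recr/= -step (le_trans (lerD IH (lexx _)))//.
  rewrite le_eqVlt; apply/orP; left; apply/eqP.
  by field; rewrite gt_eqF.
elim: n => [|n IH]; first by rewrite big_ord0 mulr_ge0 ?powR_ge0// invr_ge0 ltW.
rewrite big_ord_recr/=; case: ltP => [lt|_]; last by rewrite mulr0 addr0.
rewrite mulr1; apply: (@le_trans _ _ (\sum_(k < n.+1) (s * 2 ^+ k) `^ e)).
  rewrite big_ord_recr/= lerD2r; apply: ler_sum => i _.
  by rewrite ler_piMr ?powR_ge0//; case: (_ < _).
apply: le_trans (full _) _; rewrite -step ler_pM2r ?invr_gt0//.
by apply: ge0_ler_powR; rewrite ?nnegrE// ltW// mulr_gt0// exprn_gt0.
Qed.

Lemma dyadic_level (s t : R) m : 2 * s < t <= 2 * (s * 2 ^+ m) ->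
  exists2 k, (k < m)%N & 2 * (s * 2 ^+ k) < t <= 4 * (s * 2 ^+ k).
Proof.
move=> /andP[st]; elim: m => [|m IH] tm.
  by move: (lt_le_trans st tm); rewrite expr0 mulr1 ltxx.
have [/IH[k km kt]|mt] := leP t (2 * (s * 2 ^+ m)).
  by exists k => //; exact: ltnW.
exists m => //; rewrite mt/= (le_trans tm)// exprS.
by rewrite le_eqVlt; apply/orP; left; apply/eqP; ring.
Qed.

(** With l_k = 2^(k-n), k < 2n, a value of h in the range considered lies in
    some (2 l_k, 4 l_k], so h^p is at most the sum of the (4 l_k)^p over the k
    with h > 2 l_k. The hypothesis turns the integral of each term into
    4^p A l_k^(p-1) times the integral of g over the set where g > l_k, and
    the sum over k of l_k^(p-1) 1_(g > l_k) is a geometric sum of size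
    g^(p-1). *)
Lemma truncated_layer_cake (g h : T -> R) (p A : R) (n : nat) :
  measurable_fun setT g -> measurable_fun setT h ->
  (forall x, 0 <= g x) -> (forall x, 0 <= h x) -> 1 < p -> 0 <= A ->
  (forall l : R, 0 < l -> (l%:E * mu [set x | (2 * l < h x)%R] <=
     A%:E * \int[mu]_x (g x * \1_[set y | (l < g y)%R] x)%:E)%E) ->
  (\int[mu]_x (h x `^ p *
      \1_[set y | (2 * 2 ^- n < h y <= 2 * 2 ^+ n)%R] x)%:E <=
   (4 `^ p * A / (1 - 2 `^ (- (p - 1))))%:E * \int[mu]_x (g x `^ p)%:E)%E.
Proof.
move=> mg mh g0 h0 p1 A0 weak.
have p0 : 0 < p by apply: lt_trans p1.
have e0 : 0 < p - 1 by rewrite subr_gt0.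
pose s : R := 2 ^- n; have s0 : 0 < s by rewrite invr_gt0 exprn_gt0.
pose l k := s * 2 ^+ k.
have l0 k : 0 < l k by rewrite mulr_gt0// exprn_gt0.
have mind (f : T -> R) c : measurable_fun setT f ->
    measurable_fun setT (\1_[set y | (c < f y)%R] : T -> R).
  by move=> mf; apply/measurable_indic/measurable_superlevel.
have mpow (f : T -> R) c : measurable_fun setT f ->
    measurable_fun setT (fun x => f x `^ c).
  by move=> mf; apply: (measurableT_comp (measurable_powR _) mf).
apply: (@le_trans _ _ (\int[mu]_x \sum_(k < (n + n)%N)
    ((4 * l k) `^ p * \1_[set y | (2 * l k < h y)%R] x)%:E)%E).
  apply: ge0_le_integral => //.
  - by move=> x _; rewrite lee_fin mulr_ge0// powR_ge0.
  - apply/measurable_EFinP; apply: measurable_funM; first exact: mpow.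
    apply: measurable_indic.
    exact: measurable_level_band.
  - apply: emeasurable_sum => k; apply/measurable_EFinP.
    by apply: measurable_funM => //; exact: mind.
  - move=> x _; rewrite sumEFin lee_fin indicE; case: (boolP (_ \in _)); last first.
      by rewrite mulr0 => _; apply: sumr_ge0 => k _; rewrite mulr_ge0 ?powR_ge0.
    rewrite inE/= => hx.
    have [|k kn /andP[k1 k2]] := @dyadic_level s (h x) (n + n)%N.
      move: hx; congr (_ && (_ <= _)); by rewrite /s exprD mulKf// gt_eqF// exprn_gt0.
    rewrite mulr1 (bigD1 (Ordinal kn))//= -[leLHS]addr0 lerD//.
      rewrite indicE mem_set//= mulr1 ge0_ler_powR ?nnegrE ?(ltW p0)//.
      by rewrite mulr_ge0// ltW.
    by apply: sumr_ge0 => i _; rewrite mulr_ge0 ?powR_ge0.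
rewrite ge0_integral_sum; [|exact: measurableT|
  |by move=> k x _; rewrite lee_fin mulr_ge0 ?powR_ge0]; last first.
  move=> k; apply/measurable_EFinP.
  by apply: measurable_funM => //; exact: mind.
apply: (@le_trans _ _ (\sum_(k < (n + n)%N) \int[mu]_x
    ((4 `^ p * A)%:E * (l k `^ (p - 1) * (g x * \1_[set y | (l k < g y)%R] x))%:E))%E).
  apply: lee_sum => k _.
  under eq_integral do rewrite EFinM.
  rewrite ge0_integralZl_EFin; [|exact: measurableT
    |by move=> x _; rewrite lee_fin|by apply/measurable_EFinP; exact: mind
    |exact: powR_ge0].
  rewrite integral_indic ?setIT//; last exact: measurable_superlevel.
  rewrite ge0_integralZl_EFin; [|exact: measurableT
    |by move=> x _; rewrite lee_fin !mulr_ge0 ?powR_ge0|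
    |by rewrite mulr_ge0 ?powR_ge0]; last first.
    apply/measurable_EFinP; apply: measurable_funM => //.
    by apply: measurable_funM => //; exact: mind.
  under eq_integral do rewrite EFinM.
  rewrite ge0_integralZl_EFin; [|exact: measurableT
    |by move=> x _; rewrite lee_fin mulr_ge0| |exact: powR_ge0]; last first.
    by apply/measurable_EFinP; apply: measurable_funM => //; exact: mind.
  have -> : (4 * l k) `^ p = 4 `^ p * (l k) `^ (p - 1) * l k.
    rewrite powRM ?(ltW (l0 k))// -mulrA; congr (_ * _).
    by rewrite mulrC mulr_powRB1// ltW.
  rewrite EFinM -muleA; apply: le_trans.
    apply: lee_pmul; [| |exact: lexx|exact: (weak _ (l0 k))].
    by rewrite lee_fin mulr_ge0 ?powR_ge0.
    by rewrite mule_ge0// lee_fin ltW.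
  by rewrite !EFinM !muleA lee_pmul//; rewrite ?integral_ge0//; [
    by rewrite !mule_ge0 ?lee_fin ?powR_ge0|
    by move=> x _; rewrite lee_fin mulr_ge0|
    by rewrite muleAC].
rewrite -ge0_integral_sum; [|exact: measurableT| |]; last 2 first.
- move=> k; apply: measurable_funeM; apply/measurable_EFinP.
  by apply: measurable_funM => //; apply: measurable_funM => //; exact: mind.
- by move=> k x _; rewrite mule_ge0// lee_fin !mulr_ge0 ?powR_ge0.
have u1 : 0 < 1 - 2 `^ (- (p - 1)) :> R.
  by rewrite subr_gt0 pow2N_lt1.
rewrite -ge0_integralZl_EFin; [|exact: measurableT
  |by move=> x _; rewrite lee_fin powR_ge0
  |by apply/measurable_EFinP; exact: mpow
  |by rewrite !mulr_ge0 ?powR_ge0// invr_ge0 ltW].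
apply: ge0_le_integral => //.
- by move=> x _; apply: sume_ge0 => k _; rewrite mule_ge0// lee_fin !mulr_ge0 ?powR_ge0.
- apply: emeasurable_sum => k; apply: measurable_funeM; apply/measurable_EFinP.
  by apply: measurable_funM => //; apply: measurable_funM => //; exact: mind.
- by apply: measurable_funeM; apply/measurable_EFinP; exact: mpow.
move=> x _; rewrite -ge0_sume_distrr; last first.
  by move=> k _; rewrite lee_fin !mulr_ge0 ?powR_ge0.
rewrite sumEFin -!EFinM lee_fin -!mulrA ler_wpM2l ?powR_ge0// ler_wpM2l//.
under eq_bigr do rewrite mulrCA.
rewrite -mulr_sumr -(mulr_powRB1 (g0 x) p0) mulrCA ler_wpM2l//.
have := geometric_levels (n + n) e0 s0 (g0 x); rewrite mulrC.
congr (_ <= _); apply: eq_bigr => k _; rewrite /l indicE; congr (_ * (_ : bool)%:R).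
by apply/idP/idP => [?|]; rewrite inE.
Qed.

(** The discrete form of Marcinkiewicz interpolation. The weak inequality is
    assumed in the form that involves, at level l, only the part of g above
    l. *)
Lemma strong_of_weak (g h : T -> R) (p A : R) :
  measurable_fun setT g -> measurable_fun setT h ->
  (forall x, 0 <= g x) -> (forall x, 0 <= h x) -> 1 < p -> 0 <= A ->
  (forall l : R, 0 < l -> (l%:E * mu [set x | (2 * l < h x)%R] <=
     A%:E * \int[mu]_x (g x * \1_[set y | (l < g y)%R] x)%:E)%E) ->
  (\int[mu]_x (h x `^ p)%:E <=
   (4 `^ p * A / (1 - 2 `^ (- (p - 1))))%:E * \int[mu]_x (g x `^ p)%:E)%E.
Proof.
move=> mg mh g0 h0 p1 A0 weak.
pose E n := [set y | (2 * 2 ^- n < h y <= 2 * 2 ^+ n)%R].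
have mE n : measurable (E n) by exact: measurable_level_band.
have twoX m k : (m <= k)%N -> 2 ^+ m <= 2 ^+ k :> R.
  by move=> ?; rewrite ler_weXn2l// ler1n.
have Enm m n : (m <= n)%N -> E m `<=` E n.
  move=> mn x /= /andP[mx xm]; apply/andP; split.
    apply: le_lt_trans mx; rewrite ler_pM2l// lef_pV2 ?posrE ?exprn_gt0//.
    exact: twoX.
  by apply: le_trans xm _; rewrite ler_pM2l//; exact: twoX.
pose f n x : \bar R := (h x `^ p * \1_(E n) x)%:E.
have f0 n x : (0 <= f n x)%E by rewrite lee_fin mulr_ge0 ?powR_ge0.
have mf n : measurable_fun setT (f n).
  apply/measurable_EFinP; apply: measurable_funM; last exact: measurable_indic.
  exact: (measurableT_comp (measurable_powR _) mh).
have fnd x : {homo f ^~ x : n m / (n <= m)%N >-> (n <= m)%E}.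
  move=> n m nm; rewrite lee_fin ler_wpM2l ?powR_ge0// !indicE ler_nat.
  case: (boolP (x \in E n)) => // xn; rewrite mem_set//.
  by apply: (Enm _ _ nm); exact: set_mem.
have flim x : limn (f ^~ x) = (h x `^ p)%:E.
  apply/cvg_lim => //; apply: cvg_near_cst.
  have [hx0|hx0] := eqVneq (h x) 0.
    apply: nearW => n; rewrite /f hx0 powR0 ?mul0r//.
    by rewrite gt_eqF// (lt_trans ltr01).
  have hx : 0 < h x by rewrite lt_neqAle eq_sym hx0 h0.
  have h2 : 0 < h x / 2 by rewrite divr_gt0.
  have := near_infty_natSinv_lt (PosNum h2); have := nbhs_infty_ger (h x).
  apply: filterS2 => n hn nh; rewrite /f indicE mem_set ?mulr1//=.
  have n2 : n.+1%:R <= 2 ^+ n :> R by rewrite -natrX ler_nat ltn_expl.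
  apply/andP; split; last first.
    apply: le_trans hn _; apply: (@le_trans _ _ (2 ^+ n)).
      by apply: le_trans n2; rewrite ler_nat.
    by rewrite ler_peMl ?exprn_ge0// ler1n.
  rewrite mulrC -ltr_pdivlMr//; apply: le_lt_trans nh.
  by rewrite lef_pV2 ?posrE ?exprn_gt0.
under eq_integral do rewrite -flim.
rewrite monotone_convergence//; apply: lime_le.
  apply: ereal_nondecreasing_is_cvgn => n m nm.
  by apply: ge0_le_integral => // x _; exact: fnd.
by apply: nearW => n; exact: truncated_layer_cake.
Qed.

End LayerCake.

(** * The maximal function of a finite family of balls *)

Section MaximalFunction.
Context d (T : measurableType d) (R : realType).
Variables (mu : {measure set T -> \bar R}) (dist : T -> T -> R).
Variables (Q : nat) (c0 c1 : R).
Hypothesis reg : ahlfors_regular mu dist Q c0 c1.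

Let mball x r : measurable (qball dist x r) := measurable_qball reg x r.

Let c0_gt0 : 0 < c0. Proof. exact: lt_le_trans ltr01 (quasi_ge1 reg). Qed.

Lemma measure_bigsetU_le (I : eqType) (F : I -> set T) (s : seq I) :
  (forall i, measurable (F i)) ->
  (mu (\big[setU/set0]_(i <- s) F i) <= \sum_(i <- s) mu (F i))%E.
Proof.
move=> mF; elim: s => [|i s IH]; first by rewrite !big_nil measure0.
rewrite !big_cons; apply: le_trans (measureU2 _ _ _) _ => //.
  exact: bigsetU_measurable.
exact: leeD.
Qed.

(** The union of the balls has measure at most (3 c0^2)^Q times that of a
    disjoint subfamily, over which the integrals of g add up. *)
Lemma weak_type_finite (s : seq (T * R)) (g : T -> \bar R) (l : R) :
  0 <= l -> measurable_fun setT g -> (forall x, 0 <= g x)%E ->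
  (forall i, i \in s -> 0 < i.2 /\ (l%:E * mu (qball dist i.1 i.2) <=
     \int[mu]_(x in qball dist i.1 i.2) g x)%E) ->
  (l%:E * mu (\big[setU/set0]_(i <- s) qball dist i.1 i.2) <=
   ((3 * c0 ^+ 2) ^+ Q)%:E * \int[mu]_x g x)%E.
Proof.
move=> l0 mg g0 sl; have [t [ut ts tt st]] := vitali_finite reg s.
set K := 3 * c0 ^+ 2.
have K0 : 0 < K by rewrite mulr_gt0// exprn_gt0.
have cover : (mu (\big[setU/set0]_(i <- s) qball dist i.1 i.2) <=
    \sum_(i <- t) (K ^+ Q)%:E * mu (qball dist i.1 i.2))%E.
  apply: (@le_trans _ _ (mu (\big[setU/set0]_(i <- t) qball dist i.1 (K * i.2)))).
    apply: le_measure; rewrite ?inE; try exact: bigsetU_measurable.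
    rewrite -!bigcup_seq => x [i is_ ix]; have [i0 _] := sl _ is_.
    by have [j jt ij] := st _ is_ i0; exists j => //; exact: ij.
  apply: le_trans (measure_bigsetU_le _ _) _ => //.
  rewrite big_seq [leRHS]big_seq; apply: lee_sum => i /ts /sl[i0 _].
  rewrite !(measure_qball reg) ?mulr_gt0// -EFinM lee_fin exprMn.
  by rewrite mulrCA.
apply: (@le_trans _ _ (l%:E * (\sum_(i <- t) (K ^+ Q)%:E * mu (qball dist i.1 i.2)))%E).
  by rewrite lee_wpmul2l.
rewrite -ge0_sume_distrr; last by move=> i _; exact: measure_ge0.
rewrite muleCA lee_wpmul2l ?lee_fin ?exprn_ge0 ?(ltW K0)//.
rewrite ge0_sume_distrr; last by move=> i _; exact: measure_ge0.
apply: (@le_trans _ _ (\sum_(i <- t) \int[mu]_(x in qball dist i.1 i.2) g x)%E).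
  by rewrite big_seq [leRHS]big_seq; apply: lee_sum => i /ts /sl[].
rewrite -ge0_integral_bigsetU//; last exact: measurable_funTS.
by apply: ge0_subset_integral => //; exact: bigsetU_measurable.
Qed.

Definition average (g : T -> R) (i : T * R) : R :=
  (c1 * i.2 ^+ Q)^-1 * fine (\int[mu]_(x in qball dist i.1 i.2) (g x)%:E).

Definition maximal_seq (s : seq (T * R)) (g : T -> R) (x : T) : R :=
  \big[Num.max/0]_(i <- s) (average g i * \1_(qball dist i.1 i.2) x).

Lemma maximal_seq_ge0 s g x : 0 <= maximal_seq s g x.
Proof.
rewrite /maximal_seq; elim: s => [|i s IH]; first by rewrite big_nil.
by rewrite big_cons le_max IH orbT.
Qed.

Lemma le_maximal_seq s g x i : i \in s -> qball dist i.1 i.2 x ->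
  average g i <= maximal_seq s g x.
Proof.
rewrite /maximal_seq; elim: s => // j s IH; rewrite in_cons big_cons le_max.
move=> /orP[/eqP <- ix|/IH{}IH /IH ->]; last by rewrite orbT.
by rewrite indicE mem_set// mulr1 lexx.
Qed.

Lemma maximal_seq_gt s g x l : 0 <= l -> l < maximal_seq s g x ->
  exists i, [/\ i \in s, qball dist i.1 i.2 x & l < average g i].
Proof.
move=> l0; rewrite /maximal_seq; elim: s => [|j s IH].
  by rewrite big_nil ltNge l0.
rewrite big_cons lt_max => /orP[|/IH[i [is_ ix li]]]; last first.
  by exists i; split => //; rewrite in_cons is_ orbT.
rewrite indicE; case: (boolP (x \in _)) => [|_]; last first.
  by rewrite mulr0 ltNge l0.
by rewrite inE mulr1 => jx lj; exists j; rewrite mem_head.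
Qed.

Lemma measurable_maximal_seq s g : measurable_fun setT (maximal_seq s g).
Proof.
rewrite /maximal_seq; elim: s => [|i s IH].
  by under eq_fun do rewrite big_nil; exact: measurable_cst.
under eq_fun do rewrite big_cons.
apply: measurable_maxr => //; apply: measurable_funM => //.
Qed.

Lemma sub_maximal_seq s t g x : {subset s <= t} ->
  maximal_seq s g x <= maximal_seq t g x.
Proof.
move=> st; rewrite leNgt; apply/negP.
move=> /(maximal_seq_gt (maximal_seq_ge0 _ _ _))[i [is_ ix]].
by rewrite ltNge (le_maximal_seq g (st _ is_)).
Qed.

(** The constant that [strong_of_weak] yields for the weak-type constant
    (3 c0^2)^Q of [weak_type_finite]. *)
Definition strong_cst (p : R) : R :=
  4 `^ p * (3 * c0 ^+ 2) ^+ Q / (1 - 2 `^ (- (p - 1))).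

(** The part of g below l contributes at most l to a mean, so a ball where the
    mean of g exceeds 2 l is one where the mean of g 1_(g > l) exceeds l. *)
Lemma maximal_seq_Lp (s : seq (T * R)) (g : T -> R) (p : R) : 1 < p ->
  measurable_fun setT g -> (forall x, 0 <= g x) ->
  (forall i, i \in s -> 0 < i.2) ->
  (forall z r, \int[mu]_(x in qball dist z r) (g x)%:E < +oo)%E ->
  (\int[mu]_x (maximal_seq s g x `^ p)%:E <=
    (strong_cst p)%:E * \int[mu]_x (g x `^ p)%:E)%E.
Proof.
move=> p1 mg g0 s0 gfin.
have K0 : 0 <= (3 * c0 ^+ 2) ^+ Q.
  by rewrite exprn_ge0// mulr_ge0// exprn_ge0// ltW.
apply: strong_of_weak => //; first exact: measurable_maximal_seq.
  by move=> x; exact: maximal_seq_ge0.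
move=> l l0; set s' := [seq i <- s | 2 * l < average g i].
rewrite (_ : [set x | _] = \big[setU/set0]_(i <- s') qball dist i.1 i.2); last first.
  rewrite -bigcup_seq; apply/seteqP; split => x /=.
    move=> /(maximal_seq_gt _)[|i [is_ ix li]]; first by rewrite mulr_ge0// ltW.
    by exists i => //=; rewrite mem_filter li.
  move=> [i /=]; rewrite mem_filter => /andP[li is_] ix.
  exact: lt_le_trans li (le_maximal_seq g is_ ix).
apply: weak_type_finite (ltW l0) _ _ _.
- apply/measurable_EFinP; apply: measurable_funM => //.
  exact/measurable_indic/measurable_superlevel.
- by move=> x; rewrite lee_fin mulr_ge0.
move=> i; rewrite mem_filter => /andP[li /s0 i0]; split => //.
set B := qball dist i.1 i.2; have mB : measurable B by exact: mball.
have V0 : 0 < c1 * i.2 ^+ Q by rewrite mulr_gt0 ?exprn_gt0// (volume_gt0 reg).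
have muB : mu B = (c1 * i.2 ^+ Q)%:E by rewrite (measure_qball reg).
have fB : (\int[mu]_(x in B) (g x)%:E \is a fin_num)%E.
  rewrite ge0_fin_numE; first exact: gfin.
  by apply: integral_ge0 => x _; rewrite lee_fin.
have mgB : measurable_fun B (fun x => (g x * \1_[set y | l < g y] x)%:E).
  apply: measurable_funTS; apply/measurable_EFinP; apply: measurable_funM => //.
  exact/measurable_indic/measurable_superlevel.
have : ((2 * l)%:E * mu B <= \int[mu]_(x in B) (g x)%:E)%E.
  move: li; rewrite /average [ltRHS]mulrC ltr_pdivlMr// -/B muB.
  by rewrite -(fineK fB) -EFinM lee_fin => /ltW.
have : (\int[mu]_(x in B) (g x)%:E <=
    \int[mu]_(x in B) (g x * \1_[set y | l < g y] x)%:E + l%:E * mu B)%E.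
  rewrite -integral_cst// -ge0_integralD//; last 2 first.
  - by move=> x _; rewrite lee_fin mulr_ge0.
  - by move=> x _; rewrite lee_fin ltW.
  apply: ge0_le_integral => //.
  - by move=> x _; rewrite lee_fin.
  - by apply/measurable_EFinP; exact: measurable_funTS.
  - by apply: emeasurable_funD => //; exact: measurable_cst.
  move=> x _; rewrite -EFinD lee_fin indicE; case: (boolP (x \in _)) => [_|].
    by rewrite mulr1 lerDl ltW.
  by move=> xl; rewrite mulr0 add0r leNgt; apply: contra xl; rewrite inE.
move=> h1 h2; move: (le_trans h2 h1); rewrite mulrDl mul1r EFinD.
rewrite ge0_muleDl ?lee_fin ?(ltW l0)// leeD2rE//.
by rewrite muB -EFinM.
Qed.

End MaximalFunction.

(** * Comparison of integrals without measurability *)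

Section LowerIntegral.
Context d (T : measurableType d) (R : realType).
Variable (mu : {measure set T -> \bar R}).
Local Open Scope ereal_scope.

Lemma le_integral_pointwise (f g : T -> \bar R) :
  (forall x, 0 <= f x) -> (forall x, f x <= g x) ->
  \int[mu]_x f x <= \int[mu]_x g x.
Proof.
move=> f0 fg; rewrite !ge0_integralTE//; last first.
  by move=> x; exact: le_trans (fg x).
by apply: le_ereal_sup => _ [h hf <-]; exists h => // x; exact: le_trans (fg x).
Qed.

(** On the exceptional null set, g is replaced by +oo. *)
Lemma le_integral_ae (f g : T -> \bar R) :
  (forall x, 0 <= f x) -> (forall x, 0 <= g x) -> measurable_fun setT g ->
  {ae mu, forall x, f x <= g x} ->
  \int[mu]_x f x <= \int[mu]_x g x.
Proof.
move=> f0 g0 mg [N [mN muN fgN]].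
pose g' x := if x \in N then +oo else g x.
have -> : \int[mu]_x g x = \int[mu]_x g' x.
  apply: ge0_ae_eq_integral => //.
  - apply: measurable_fun_if => //.
    + apply: (measurable_fun_bool true) => //.
      rewrite setTI (_ : _ @^-1` _ = N)//.
      by apply/seteqP; split => x /=; [move=> /set_mem|move=> /mem_set].
    + exact: measurable_funTS.
  - by move=> x _; rewrite /g'; case: ifP.
  - exists N; split => // x /=; apply: contra_notP => xN _; rewrite /g' memNset//.
apply: le_integral_pointwise => // x; rewrite /g'; case: ifPn => [|/negP xN].
  by rewrite leey.
by apply: contrapT => fgx; apply: xN; rewrite inE; apply: fgN.
Qed.

End LowerIntegral.

(** * The Hardy-Littlewood maximal theorem *)

Section MaximalTheorem.
Context d (T : measurableType d) (R : realType).
Variables (mu : {measure set T -> \bar R}) (dist : T -> T -> R).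
Variables (Q : nat) (c0 c1 : R).
Hypothesis reg : ahlfors_regular mu dist Q c0 c1.

Let mball x r : measurable (qball dist x r) := measurable_qball reg x r.

Let c0_gt0 : 0 < c0. Proof. exact: lt_le_trans ltr01 (quasi_ge1 reg). Qed.

Definition dense_seq (z : nat -> T) : Prop :=
  forall x r, 0 < r -> exists n, dist x (z n) < r.

Section Enumeration.
Variable z : nat -> T.

Definition rational_ball (n : nat) : seq (T * R) :=
  if unpickle n is Some (k, q) then
    if 0 < ratr q :> R then [:: (z k, ratr q)] else [::]
  else [::].

Definition rational_balls (n : nat) : seq (T * R) :=
  flatten [seq rational_ball k | k <- iota 0 n].

Lemma rational_balls_gt0 n i : i \in rational_balls n -> 0 < i.2.
Proof.
move=> /flattenP[s /mapP[k _ ->]]; rewrite /rational_ball.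
by case: unpickle => // -[j q]; case: ifP => // q0; rewrite inE => /eqP ->.
Qed.

Lemma sub_rational_balls m n : (m <= n)%N ->
  {subset rational_balls m <= rational_balls n}.
Proof.
move=> mn i /flattenP[s /mapP[k]]; rewrite mem_iota add0n => /andP[_ km] -> ik.
apply/flattenP; exists (rational_ball k) => //; apply/map_f.
by rewrite mem_iota add0n (leq_trans km).
Qed.

Lemma mem_rational_balls k (q : rat) : 0 < ratr q :> R ->
  (z k, ratr q) \in rational_balls (pickle (k, q)).+1.
Proof.
move=> q0; apply/flattenP; exists (rational_ball (pickle (k, q))).
  by apply/map_f; rewrite mem_iota add0n ltnS leqnn.
by rewrite /rational_ball pickleK q0 mem_head.
Qed.

End Enumeration.

Lemma average_le (g : T -> R) w r w' r' : 0 < r -> 0 < r' <= 4 * c0 * r ->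
  measurable_fun setT g -> (forall x, 0 <= g x) ->
  (\int[mu]_(x in qball dist w' r') (g x)%:E < +oo)%E ->
  qball dist w r `<=` qball dist w' r' ->
  average mu dist Q c1 g (w, r) <= (4 * c0) ^+ Q * average mu dist Q c1 g (w', r').
Proof.
move=> r0 /andP[r'0 rr'] mg g0 gfin sub; rewrite /average/=.
have c10 := volume_gt0 reg.
have mgE D : measurable_fun D (EFin \o g).
  by apply: measurable_funTS; apply/measurable_EFinP.
have le_int : (\int[mu]_(x in qball dist w r) (g x)%:E <=
    \int[mu]_(x in qball dist w' r') (g x)%:E)%E.
  by apply: ge0_subset_integral => // x _; rewrite lee_fin.
have int0 D : (0 <= \int[mu]_(x in D) (g x)%:E)%E.
  by apply: integral_ge0 => x _; rewrite lee_fin.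
have le_fine : fine (\int[mu]_(x in qball dist w r) (g x)%:E) <=
    fine (\int[mu]_(x in qball dist w' r') (g x)%:E).
  by rewrite fine_le// ge0_fin_numE// (le_lt_trans le_int).
have V0 : 0 < c1 * r ^+ Q by rewrite mulr_gt0// exprn_gt0.
have V'0 : 0 < c1 * r' ^+ Q by rewrite mulr_gt0// exprn_gt0.
rewrite mulrA ler_pM ?invr_ge0 ?(ltW V0) ?fine_ge0//.
rewrite -[leLHS]mul1r ler_pdivrMr// mulrAC ler_pdivlMr// mul1r mulrCA ler_pM2l//.
by rewrite -exprMn lerXn2r// nnegrE ?(ltW r'0)// !mulr_ge0// ltW.
Qed.

(** Every ball is contained in a ball of comparable radius whose centre belongs
    to z and whose radius is rational, so the maximal function of a countable
    family dominates all means up to the factor (4 c0)^Q. The bound for finite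
    families is uniform and passes to the limit by monotone convergence. The
    function M is defined as a p-th root of the limit of p-th powers to make
    the last step immediate. *)
Lemma maximal_function (z : nat -> T) (p : R) (g : T -> R) :
  dense_seq z -> 1 < p -> measurable_fun setT g -> (forall x, 0 <= g x) ->
  (forall w r, \int[mu]_(x in qball dist w r) (g x)%:E < +oo)%E ->
  exists M : T -> \bar R, [/\ measurable_fun setT M, (forall x, 0 <= M x)%E,
    (forall w r x, qball dist w r x ->
      (average mu dist Q c1 g (w, r))%:E <= ((4 * c0) ^+ Q)%:E * M x)%E &
    (\int[mu]_x (M x `^ p) <=
      (strong_cst Q c0 p)%:E * \int[mu]_x (g x `^ p)%:E)%E].
Proof.
move=> zdense p1 mg g0 gfin.
have p0 : 0 < p by apply: lt_trans p1.
pose F n x : \bar R := (maximal_seq mu dist Q c1 (rational_balls z n) g x `^ p)%:E.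
have F0 n x : (0 <= F n x)%E by rewrite lee_fin powR_ge0.
have mF n : measurable_fun setT (F n).
  apply/measurable_EFinP; apply: (measurableT_comp (measurable_powR _)).
  exact: measurable_maximal_seq reg _ _.
have Fnd x : {homo F ^~ x : n m / (n <= m)%N >-> (n <= m)%E}.
  move=> n m nm; rewrite lee_fin ge0_ler_powR ?nnegrE ?maximal_seq_ge0 ?(ltW p0)//.
  by apply: sub_maximal_seq; exact: sub_rational_balls.
have Fcvg x : cvgn (F ^~ x) by exact: ereal_nondecreasing_is_cvgn.
have limF0 x : (0 <= limn (F ^~ x))%E by apply: lime_ge => //; exact: nearW.
have leF n x : (F n x <= limn (F ^~ x))%E.
  have /cvg_lim -> // := ereal_nondecreasing_cvgn (Fnd x).
  by apply: ereal_sup_ubound; exists n.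
have mlim : measurable_fun setT (fun x => limn (F ^~ x)).
  by apply: (emeasurable_fun_cvg F) => // x _; exact: Fcvg.
exists (fun x => (limn (F ^~ x) `^ p^-1)%E); split.
- by apply: (measurableT_comp (measurable_poweR _)).
- by move=> x; exact: poweR_ge0.
- move=> w r x wx.
  have r0 : 0 < r by apply: le_lt_trans wx; exact: dist_ge0 reg _ _.
  have [k wk] := zdense w _ r0.
  (* A radius larger than 2 c0 r makes the new ball contain B(w, r). *)
  have /rat_in_itvoo[q] : 2 * c0 * r < 4 * c0 * r.
    by rewrite !ltr_pM2r// ltr_nat.
  rewrite in_itv/= => /andP[q1 q2].
  have q0 : 0 < ratr q :> R by apply: lt_trans q1; rewrite !mulr_gt0.
  have sub : qball dist w r `<=` qball dist (z k) (ratr q).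
    move=> y wy; rewrite (dist_sym reg) in wk.
    apply: lt_trans (qball_tri reg wk wy) _; apply: le_lt_trans q1.
    by rewrite le_eqVlt; apply/orP; left; apply/eqP; ring.
  apply: (@le_trans _ _ ((4 * c0) ^+ Q * average mu dist Q c1 g (z k, ratr q))%:E).
    by rewrite lee_fin; apply: average_le => //; rewrite q0 ltW.
  rewrite EFinM lee_wpmul2l ?lee_fin ?exprn_ge0 ?mulr_ge0 ?(ltW c0_gt0)//.
  set n := (pickle (k, q)).+1.
  apply: (@le_trans _ _ (maximal_seq mu dist Q c1 (rational_balls z n) g x)%:E).
    rewrite lee_fin; apply: le_maximal_seq; first exact: mem_rational_balls.
    exact: sub.
  have -> : (maximal_seq mu dist Q c1 (rational_balls z n) g x)%:E = (F n x `^ p^-1)%E.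
    rewrite /F poweR_EFin -powRrM mulfV ?gt_eqF// powRr1//.
    exact: maximal_seq_ge0.
  by apply: gt0_ler_poweR; rewrite ?invr_ge0 ?(ltW p0)// in_itv/= ?leey ?andbT.
under eq_integral => x _.
  rewrite -poweRrM mulVf ?gt_eqF// poweRe1//; over.
rewrite monotone_convergence//; apply: lime_le.
  apply: ereal_nondecreasing_is_cvgn => n m nm.
  by apply: ge0_le_integral => // x _; exact: Fnd.
apply: nearW => n; apply: maximal_seq_Lp => //.
by move=> i; exact: rational_balls_gt0.
Qed.

Lemma holder_qball (f : T -> R) (p : R) w r : 1 < p -> 0 < r ->
  measurable_fun setT f ->
  (\int[mu]_(x in qball dist w r) (`|f x|)%:E <=
    'N[mu]_p%:E[EFin \o f] * ((c1 * r ^+ Q) `^ (1 - p^-1))%:E)%E.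
Proof.
move=> p1 r0 mf; have p0 : 0 < p by apply: lt_trans p1.
have q0 : 0 < 1 - p^-1 by rewrite subr_gt0 invf_lt1.
have := @hoelder _ _ _ mu f (\1_(qball dist w r)) p (1 - p^-1)^-1 mf
  (measurable_indic (mball w r)) p0.
rewrite invr_gt0 invrK => /(_ q0); rewrite addrC subrK => /(_ erefl).
congr (_ <= _ * _)%E.
  rewrite Lnorm1 [RHS]integral_mkcond; apply: eq_integral => x _.
  rewrite epatch_indic /= normrM EFinM; congr (_ * _)%E.
  by rewrite ger0_norm.
rewrite unlock invrK.
rewrite (eq_integral (fun x => (\1_(qball dist w r) x)%:E)); last first.
  move=> x _; rewrite gee0_abs ?lee_fin//= indicE.
  by case: (x \in _); rewrite ?powR1 ?powR0// invr_eq0 gt_eqF.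
by rewrite integral_indic// setIT (measure_qball reg)// poweR_EFin.
Qed.

(** Here V is the volume of a ball, I the integral of |f| over it and N the L^p
    norm of f: the left-hand side is the product of (I / V)^(1 - g p) and
    (V^(1/p - 1) I)^(g p), since the exponents of V and of I match. *)
Lemma hedberg_interpolation (V I N g p : R) : 0 < V -> 0 <= I -> 0 <= N ->
  0 < p -> 0 < g * p < 1 -> I <= N * V `^ (1 - p^-1) ->
  V `^ (g - 1) * I <= (V^-1 * I) `^ (1 - g * p) * N `^ (g * p).
Proof.
move=> V0 I0 N0 p0 /andP[gp0 gp1] IN; set t := g * p.
have Vn0 : V != 0 by rewrite gt_eqF.
have -> : V `^ (g - 1) * I = (V^-1 * I) `^ (1 - t) * (V `^ (p^-1 - 1) * I) `^ t.
  rewrite !powRM ?invr_ge0 ?powR_ge0 ?(ltW V0)//.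
  rewrite mulrACA -powRD ?subrK ?oner_eq0// powRr1//; congr (_ * _).
  rewrite -powR_inv1 ?(ltW V0)// -!powRrM -powRD ?Vn0 ?implybT//.
  congr (_ `^ _); rewrite /t; field.
  by rewrite gt_eqF.
rewrite ler_wpM2l ?powR_ge0//; apply: ge0_ler_powR; rewrite ?nnegrE ?(ltW gp0)//.
  by rewrite mulr_ge0 ?powR_ge0.
apply: (@le_trans _ _ (V `^ (p^-1 - 1) * (N * V `^ (1 - p^-1)))).
  by rewrite ler_wpM2l ?powR_ge0.
rewrite mulrCA -powRD ?Vn0 ?implybT// addrA subrK subrr powRr0 mulr1.
exact: lexx.
Qed.

End MaximalTheorem.

(** * Commutators with Lipschitz functions *)

Section Commutator.
Context d (T : measurableType d) (R : realType).
Variables (mu : {measure set T -> \bar R}) (dist : T -> T -> R).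
Variables (Q : nat) (c0 c1 : R).
Hypothesis reg : ahlfors_regular mu dist Q c0 c1.

Let mball x r : measurable (qball dist x r) := measurable_qball reg x r.

Let c0_gt0 : 0 < c0. Proof. exact: lt_le_trans ltr01 (quasi_ge1 reg). Qed.

Let c1_gt0 : 0 < c1. Proof. exact: volume_gt0 reg. Qed.

Let Q_gt0 : 0 < Q%:R :> R. Proof. by rewrite ltr0n; exact: regular_dim_gt0 reg. Qed.

Definition max_commutator (alpha : R) (b f : T -> R) (x : T) : \bar R :=
  ereal_sup [set ((fine (mu B) `^ (1 - alpha / Q%:R))^-1)%:E *
                 \int[mu]_(y in B) (`|b x - b y| * `|f y|)%:E
            | B in [set B : set T |
                (exists x r, (0 < r)%R /\ B = qball dist x r) /\ B x]]%E.

Definition ball_mean (b : T -> R) (B : set T) : R :=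
  (fine (mu B))^-1 * \int[mu]_(x in B) b x.

Definition qball_volume (r : R) := c1 * r ^+ Q.

Lemma qball_volume_gt0 r : 0 < r -> 0 < qball_volume r.
Proof. by move=> r0; rewrite mulr_gt0// exprn_gt0. Qed.

Lemma measure_qball_volume x r : 0 < r -> mu (qball dist x r) = (qball_volume r)%:E.
Proof. by move=> r0; rewrite (measure_qball reg). Qed.

(** Powers of the radius are expressed through the volume, the quantity that
    normalizes all means. *)
Lemma radius_powE (r e : R) : 0 < r ->
  r `^ e = c1^-1 `^ (e / Q%:R) * qball_volume r `^ (e / Q%:R).
Proof.
move=> r0; rewrite -powRM ?invr_ge0 ?(ltW c1_gt0) ?(ltW (qball_volume_gt0 r0))//.
rewrite /qball_volume mulKf ?gt_eqF// -powR_mulrn ?(ltW r0)// -powRrM.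
by congr (_ `^ _); rewrite mulrC divfK// gt_eqF.
Qed.

Lemma dist_in_qball w r x y : qball dist w r x -> qball dist w r y ->
  dist x y <= 2 * c0 * r.
Proof.
rewrite /qball/= => wx wy; rewrite (dist_sym reg) in wx.
have := ltW (qball_tri reg wx wy).
by congr (_ <= _); ring.
Qed.

Section Lipschitz.
Variables (b b' : T -> R) (L beta : R).
Hypotheses (L0 : 0 < L) (beta0 : 0 < beta).
Hypothesis mb : measurable_fun setT b.
Hypothesis lip : forall x y, `|b' x - b' y| <= L * dist x y `^ beta.
Hypothesis bb' : {ae mu, forall x, b x = b' x}.

Let osc r := L * (2 * c0 * r) `^ beta.

Lemma lipschitz_osc w r x : qball dist w r x -> b x = b' x ->
  {ae mu, forall y, qball dist w r y -> `|b x - b y| <= osc r}.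
Proof.
move=> wx bx; apply: filterS bb' => y by_ wy; rewrite bx by_.
apply: le_trans (lip x y) _; rewrite ler_pM2l//.
have r0 : 0 < r by apply: le_lt_trans wx; exact: dist_ge0 reg _ _.
apply: ge0_ler_powR; rewrite ?nnegrE ?(ltW beta0)//; first exact: dist_ge0 reg _ _.
  by rewrite ltW// !mulr_gt0.
exact: dist_in_qball wx wy.
Qed.

Lemma lipschitz_commutator_integral (f : T -> R) w r x :
  measurable_fun setT f -> qball dist w r x -> b x = b' x ->
  (\int[mu]_(y in qball dist w r) (`|b x - b y| * `|f y|)%:E <=
   (osc r)%:E * \int[mu]_(y in qball dist w r) (`|f y|)%:E)%E.
Proof.
move=> mf wx bx.
have osc0 : 0 <= osc r by rewrite mulr_ge0 ?powR_ge0// ltW.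
have mnf D : measurable_fun D (fun y => `|f y|).
  by apply: measurable_funTS; exact: measurableT_comp.
rewrite -ge0_integralZl_EFin//; last exact/measurable_EFinP.
apply: ae_ge0_le_integral => //.
- apply/measurable_EFinP; apply: measurable_funM => //.
  apply: measurable_funTS; apply: measurableT_comp => //.
  exact: measurable_funB.
- by move=> y _; rewrite -EFinM lee_fin mulr_ge0.
- by apply: measurable_funeM; exact/measurable_EFinP.
- apply: filterS (lipschitz_osc wx bx) => y h wy.
  by rewrite -EFinM lee_fin ler_wpM2r// h.
Qed.

Lemma commutator_Lp_Lq (z : nat -> T) (alpha p q : R) :
  dense_seq dist z -> 0 < alpha ->
  1 < p < Q%:R / (alpha + beta) -> q^-1 = p^-1 - (alpha + beta) / Q%:R ->
  exists2 C : R, 0 < C & forall f : T -> R, f \in Lfun mu p%:E ->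
    ('N[mu]_(q%:E)[max_commutator alpha b f] <= C%:E * 'N[mu]_(p%:E)[EFin \o f])%E.
Proof.
move=> zdense alpha0 /andP[p1 pQ] qE.
have p0 : 0 < p by apply: lt_trans p1.
set g := (alpha + beta) / Q%:R in qE *.
have ab0 : 0 < alpha + beta by rewrite addr_gt0.
have g0 : 0 < g by rewrite divr_gt0.
have gp1 : g * p < 1.
  by rewrite /g mulrAC ltr_pdivrMr// mul1r mulrC -ltr_pdivlMr.
have gp0 : 0 < g * p by rewrite mulr_gt0.
set t := g * p in gp0 gp1.
have t1 : 0 < 1 - t by rewrite subr_gt0.
have q_p : q^-1 = p^-1 * (1 - t).
  by rewrite qE mulrBr mulr1 /t mulrCA mulVf ?mulr1// gt_eqF.
have qi0 : 0 < q^-1 by rewrite q_p mulr_gt0// invr_gt0.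
have q0 : 0 < q by rewrite -invr_gt0.
have tq : (1 - t) * q = p.
  apply: (mulIf (x := q^-1)); first by rewrite gt_eqF.
  by rewrite mulfK ?gt_eqF// q_p mulrA mulfV ?mul1r// gt_eqF.
pose K := (4 * c0) ^+ Q.
have K0 : 0 < K by rewrite exprn_gt0// mulr_gt0.
pose S := strong_cst Q c0 p.
have S0 : 0 < S.
  rewrite /S /strong_cst divr_gt0// ?mulr_gt0 ?powR_gt0// ?exprn_gt0//.
    by rewrite mulr_gt0// exprn_gt0.
  by rewrite subr_gt0 pow2N_lt1// subr_gt0.
pose A := L * (2 * c0) `^ beta * c1^-1 `^ (beta / Q%:R).
have A0 : 0 < A by rewrite !mulr_gt0// powR_gt0 ?invr_gt0// mulr_gt0.
exists (A * K `^ (1 - t) * S `^ q^-1).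
  by apply: mulr_gt0; [apply: mulr_gt0 => //|]; exact: powR_gt0.
move=> f fL.
have mf : measurable_fun setT f by exact: set_mem (sub_Lfun_mfun fL).
have Nfin : ('N[mu]_p%:E[EFin \o f] < +oo)%E by exact: set_mem (sub_Lfun_finLfun fL).
have NfinN : ('N[mu]_p%:E[EFin \o f])%E \is a fin_num.
  by rewrite ge0_fin_numE// Lnorm_ge0.
pose N := fine ('N[mu]_p%:E[EFin \o f])%E.
have NE : ('N[mu]_p%:E[EFin \o f] = N%:E)%E by rewrite fineK.
have N0 : 0 <= N by rewrite fine_ge0// Lnorm_ge0.
pose nf x := `|f x|.
have mnf : measurable_fun setT nf by exact: measurableT_comp.
have Ifin w r : 0 < r -> (\int[mu]_(x in qball dist w r) (nf x)%:E < +oo)%E.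
  by move=> r0; apply: le_lt_trans (holder_qball reg w p1 r0 mf) _;
     rewrite NE -EFinM ltry.
have Ifin' w r : (\int[mu]_(x in qball dist w r) (nf x)%:E < +oo)%E.
  have [/Ifin//|r0] := ltP 0 r.
  rewrite (_ : qball dist w r = set0) ?integral_set0//.
  apply/seteqP; split => // y; rewrite /qball/= ltNge.
  by rewrite (le_trans r0)//; exact: dist_ge0 reg _ _.
have [|M [mM M0 avgM intM]] := maximal_function reg zdense p1 mnf _ Ifin'.
  by move=> x; exact: normr_ge0.
have fp : (\int[mu]_x (nf x `^ p)%:E = (N `^ p)%:E)%E.
  by rewrite -poweR_EFin -NE poweR_Lnorm ?gt_eqF.
pose U x := ((A * N `^ t)%:E * (K%:E * M x) `^ (1 - t))%E.
have KM0 x : (0 <= K%:E * M x)%E by rewrite mule_ge0// lee_fin ltW.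
have ANt0 : 0 <= A * N `^ t by rewrite mulr_ge0 ?powR_ge0// ltW.
have U0 x : (0 <= U x)%E by rewrite mule_ge0 ?poweR_ge0.
have TU : {ae mu, forall x, (max_commutator alpha b f x <= U x)%E}.
  apply: filterS bb' => x bx; apply: ge_ereal_sup => _ [B [[w [r [r0 ->]]] wx] <-].
  have V0 := qball_volume_gt0 r0; set V := qball_volume r in V0.
  rewrite measure_qball_volume//= -/V.
  apply: (@le_trans _ _ (((V `^ (1 - alpha / Q%:R))^-1)%:E *
      ((osc r)%:E * \int[mu]_(y in qball dist w r) (nf y)%:E))%E).
    rewrite lee_wpmul2l ?lee_fin ?invr_ge0 ?powR_ge0//.
    exact: lipschitz_commutator_integral.
  set I := fine (\int[mu]_(y in qball dist w r) (nf y)%:E).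
  have Ige0 : (0 <= \int[mu]_(y in qball dist w r) (nf y)%:E)%E.
    by apply: integral_ge0 => y _; rewrite lee_fin normr_ge0.
  have IE : (\int[mu]_(y in qball dist w r) (nf y)%:E = I%:E)%E.
    by rewrite fineK// ge0_fin_numE.
  have I0 : 0 <= I by rewrite fine_ge0.
  rewrite IE -!EFinM.
  have -> : (V `^ (1 - alpha / Q%:R))^-1 * (osc r * I) = A * (V `^ (g - 1) * I).
    rewrite /osc powRM ?(ltW r0) ?mulr_ge0 ?(ltW c0_gt0)// (radius_powE _ r0) -/V.
    have -> : g - 1 = beta / Q%:R + - (1 - alpha / Q%:R) by rewrite /g; ring.
    rewrite [V `^ (beta / Q%:R + _)]powRD ?(gt_eqF V0) ?implybT// powRN /A.
    by ring.
  apply: (@le_trans _ _ (A * ((V^-1 * I) `^ (1 - t) * N `^ t))%:E).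
    rewrite lee_fin ler_pM2l//; apply: hedberg_interpolation => //.
      by apply/andP; split.
    by rewrite -lee_fin EFinM -IE -NE; exact: (holder_qball reg w p1 r0 mf).
  have -> : A * ((V^-1 * I) `^ (1 - t) * N `^ t) =
      (A * N `^ t) * (V^-1 * I) `^ (1 - t) by ring.
  rewrite EFinM /U lee_wpmul2l ?lee_fin// -poweR_EFin.
  apply: gt0_ler_poweR; rewrite ?(ltW t1)//.
  - by rewrite in_itv/= lee_fin leey mulr_ge0// invr_ge0 ltW.
  - by rewrite in_itv/= leey KM0.
  - exact: avgM wx.
have T0 x : (0 <= max_commutator alpha b f x)%E.
  apply: ereal_sup_ge.
  exists (((fine (mu (qball dist x 1)) `^ (1 - alpha / Q%:R))^-1)%:E *
      \int[mu]_(y in qball dist x 1) (`|b x - b y| * `|f y|)%:E)%E.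
    exists (qball dist x 1) => //; split; last exact: qball_center reg _ _ _.
    by exists x, 1.
  rewrite mule_ge0 ?lee_fin ?invr_ge0 ?powR_ge0//.
  by apply: integral_ge0 => y _; rewrite lee_fin mulr_ge0.
have intU : (\int[mu]_x (U x `^ q) <=
    ((A * N `^ t) `^ q * (K `^ p * (S * N `^ p)))%:E)%E.
  under eq_integral => x _.
    rewrite /U poweRM ?lee_fin ?poweR_ge0// -poweRrM tq.
    rewrite poweRM ?lee_fin ?(ltW K0)// !poweR_EFin; over.
  rewrite ge0_integralZl_EFin ?powR_ge0//; last 2 first.
  - by move=> x _; rewrite mule_ge0 ?lee_fin ?powR_ge0 ?poweR_ge0.
  - apply: measurable_funeM; exact: (measurableT_comp (measurable_poweR _)).
  rewrite ge0_integralZl_EFin ?powR_ge0//; last 2 first.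
  - by move=> x _; rewrite poweR_ge0.
  - exact: (measurableT_comp (measurable_poweR _)).
  rewrite !EFinM !lee_wpmul2l ?lee_fin ?powR_ge0//.
  by apply: le_trans intM _; rewrite fp.
apply: (@le_trans _ _ ((((A * N `^ t) `^ q * (K `^ p * (S * N `^ p)))%:E) `^ q^-1)%E).
  rewrite unlock; apply: gt0_ler_poweR; rewrite ?(ltW qi0)//.
  - by rewrite in_itv/= leey integral_ge0// => x _; rewrite poweR_ge0.
  - rewrite in_itv/= leey lee_fin andbT; do 2 (apply: mulr_ge0; rewrite ?powR_ge0//).
    by apply: mulr_ge0; rewrite ?powR_ge0// ltW.
  apply: le_trans intU; apply: le_integral_ae.
  - by move=> x; exact: poweR_ge0.
  - by move=> x; exact: poweR_ge0.
  - apply: (measurableT_comp (measurable_poweR _)).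
    apply: measurable_funeM; apply: (measurableT_comp (measurable_poweR _)).
    exact: measurable_funeM.
  - apply: filterS TU => x Tx; apply: gt0_ler_poweR; rewrite ?(ltW q0)//.
    + by rewrite in_itv/= leey abse_ge0.
    + by rewrite in_itv/= leey U0.
    + by rewrite gee0_abs.
rewrite NE poweR_EFin -EFinM lee_fin.
have SN0 : 0 <= S * N `^ p by apply: mulr_ge0; rewrite ?powR_ge0// ltW.
have KSN0 : 0 <= K `^ p * (S * N `^ p) by apply: mulr_ge0; rewrite ?powR_ge0.
rewrite (powRM _ (powR_ge0 _ _) KSN0) (powRM _ (powR_ge0 _ _) SN0).
rewrite (powRM _ (ltW S0) (powR_ge0 _ _)) -!powRrM.
have -> : p / q = 1 - t by rewrite q_p mulrA mulfV ?mul1r// gt_eqF.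
have -> : q / q = 1 by rewrite mulfV// gt_eqF.
rewrite !powRr1//.
  rewrite le_eqVlt; apply/orP; left; apply/eqP.
  have NtN : N `^ t * N `^ (1 - t) = N.
    by rewrite -powRD addrC subrK ?oner_eq0// powRr1.
  by rewrite -[in RHS]NtN; ring.
Qed.

End Lipschitz.
End Commutator.

(** * Mean oscillation *)

Section MeanOscillation.
Context d (T : measurableType d) (R : realType).
Variables (mu : {measure set T -> \bar R}) (dist : T -> T -> R).
Variables (Q : nat) (c0 c1 : R).
Hypothesis reg : ahlfors_regular mu dist Q c0 c1.

Let mball x r : measurable (qball dist x r) := measurable_qball reg x r.

Let c0_gt0 : 0 < c0. Proof. exact: lt_le_trans ltr01 (quasi_ge1 reg). Qed.

Let c1_gt0 : 0 < c1. Proof. exact: volume_gt0 reg. Qed.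

Let Q_gt0 : 0 < Q%:R :> R. Proof. by rewrite ltr0n; exact: regular_dim_gt0 reg. Qed.

Notation V := (qball_volume Q c1).

Variable b : T -> R.
Hypothesis mb : measurable_fun setT b.
Hypothesis ib : forall w r, mu.-integrable (qball dist w r) (EFin \o b).

Notation bmean w r := (ball_mean mu b (qball dist w r)).

Lemma dev_mean_le c w r X : 0 < r ->
  (\int[mu]_(y in qball dist w r) (`|c - b y|)%:E <= X%:E)%E ->
  `|c - bmean w r| <= (V r)^-1 * X.
Proof.
move=> r0; have V0 := qball_volume_gt0 reg r0.
have muB := measure_qball_volume reg w r0.
set B := qball dist w r in muB *; have mB : measurable B by exact: mball.
have ic : mu.-integrable B (EFin \o cst c).
  apply/integrableP; split; first exact/measurable_EFinP.
  rewrite (eq_integral (cst `|c|%:E)) //.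
  by rewrite integral_cst// muB -EFinM ltry.
have icb : mu.-integrable B (EFin \o (fun y => c - b y)).
  rewrite (_ : _ \o _ = (EFin \o cst c) \- (EFin \o b))%E; last by apply/funext.
  exact: (integrableB mB ic (ib w r)).
have -> : c - bmean w r = (V r)^-1 * \int[mu]_(y in B) (c - b y).
  rewrite (RintegralB mB ic (ib w r)) (Rintegral_cst mu mB) muB /=.
  rewrite mulrBr mulrCA mulVf ?mulr1 ?gt_eqF//.
  by rewrite /ball_mean -/B muB.
move=> leX; rewrite normrM ger0_norm ?invr_ge0 ?(ltW V0)// ler_pM2l ?invr_gt0//.
apply: le_trans (le_normr_Rintegral _ _) _ => //.
have ge0 : (0 <= \int[mu]_(y in B) (`|c - b y|)%:E)%E by apply: integral_ge0.
by rewrite /Rintegral -lee_fin fineK// ge0_fin_numE// (le_lt_trans leX)// ltry.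
Qed.

(** The quantity whose supremum over the balls is finite in the Campanato
    conditions. *)
Definition campanato_quotient (beta s : R) (B : set T) : \bar R :=
  ((fine (mu B) `^ (beta / Q%:R))^-1)%:E *
    (((fine (mu B))^-1)%:E *
      \int[mu]_(x in B) (`|b x - ball_mean mu b B| `^ s)%:E) `^ (s^-1).

Lemma measurable_dev D c s : measurable_fun D (fun x => (`|b x - c| `^ s)%:E).
Proof.
apply: measurable_funTS; apply/measurable_EFinP.
apply: (measurableT_comp (measurable_powR _)); apply: measurableT_comp => //.
exact: measurable_funB.
Qed.

Section LipschitzToCampanato.
Variables (b' : T -> R) (L beta : R).
Hypotheses (L0 : 0 < L) (beta0 : 0 < beta).
Hypothesis lip : forall x y, `|b' x - b' y| <= L * dist x y `^ beta.
Hypothesis bb' : {ae mu, forall x, b x = b' x}.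

Lemma lipschitz_campanato s w r : 1 <= s -> 0 < r ->
  (campanato_quotient beta s (qball dist w r) <=
   (L * (2 * c0) `^ beta * c1^-1 `^ (beta / Q%:R))%:E)%E.
Proof.
move=> s1 r0; have s0 : 0 < s by apply: lt_le_trans s1.
have V0 := qball_volume_gt0 reg r0.
rewrite /campanato_quotient; have muB := measure_qball_volume reg w r0; rewrite muB /=.
set B := qball dist w r in muB *; have mB : measurable B by exact: mball.
set v := V r in V0 muB *.
set o := L * (2 * c0 * r) `^ beta.
have o0 : 0 <= o by rewrite mulr_ge0 ?powR_ge0// ltW.
have dev x : B x -> b x = b' x -> `|b x - bmean w r| <= o.
  move=> Bx bx; have -> : o = v^-1 * (o * v) by rewrite mulrCA mulVf ?mulr1// gt_eqF.
  apply: dev_mean_le => //; rewrite EFinM -muB -integral_cst//.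
  apply: ae_ge0_le_integral => //.
  - apply/measurable_EFinP; apply: measurable_funTS; apply: measurableT_comp => //.
    exact: measurable_funB.
  - apply: filterS (lipschitz_osc reg L0 beta0 lip bb' Bx bx) => y h By.
    by rewrite /= lee_fin h.
have int_le : (\int[mu]_(x in B) (`|b x - bmean w r| `^ s)%:E <= (o `^ s * v)%:E)%E.
  rewrite EFinM -muB -integral_cst//; apply: ae_ge0_le_integral => //.
  - exact: measurable_dev.
  - by move=> x _; rewrite lee_fin powR_ge0.
  - apply: filterS bb' => x bx Bx; rewrite lee_fin.
    by apply: ge0_ler_powR; rewrite ?nnegrE ?(ltW s0)// dev.
apply: (@le_trans _ _ ((v `^ (beta / Q%:R))^-1%:E * (o `^ s)%:E `^ s^-1)%E).
  rewrite lee_wpmul2l ?lee_fin ?invr_ge0 ?powR_ge0//.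
  have int0 : (0 <= \int[mu]_(x in B) (`|b x - bmean w r| `^ s)%:E)%E.
    by apply: integral_ge0 => x _; rewrite lee_fin powR_ge0.
  apply: gt0_ler_poweR; rewrite ?invr_ge0 ?(ltW s0)//.
  - by rewrite in_itv/= leey mule_ge0// lee_fin invr_ge0 ltW.
  - by rewrite in_itv/= leey lee_fin powR_ge0.
  have -> : o `^ s = v^-1 * (o `^ s * v) by rewrite mulrCA mulVf ?mulr1// gt_eqF.
  by rewrite EFinM lee_wpmul2l// lee_fin invr_ge0 ltW.
rewrite poweR_EFin -powRrM mulfV ?gt_eqF// powRr1// -EFinM lee_fin.
rewrite /o powRM ?(ltW r0) ?mulr_ge0 ?(ltW c0_gt0)// (radius_powE reg _ r0) -/v.
rewrite le_eqVlt; apply/orP; left; apply/eqP.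
by field; rewrite !gt_eqF ?powR_gt0.
Qed.

End LipschitzToCampanato.

(** The function f is the indicator of the ball, whose L^p norm is |B|^(1/p).
    The hypothesis on q makes the powers of |B| cancel. *)
Lemma commutator_campanato (alpha beta p q C : R) w r : 0 < r -> 0 < p -> 0 < q ->
  0 < C -> q^-1 = p^-1 - (alpha + beta) / Q%:R ->
  (forall f : T -> R, f \in Lfun mu p%:E ->
    ('N[mu]_(q%:E)[max_commutator mu dist Q alpha b f] <=
      C%:E * 'N[mu]_(p%:E)[EFin \o f])%E) ->
  (campanato_quotient beta q (qball dist w r) <= C%:E)%E.
Proof.
move=> r0 p0 q0 C0 qE bound; have V0 := qball_volume_gt0 reg r0.
rewrite /campanato_quotient; have muB := measure_qball_volume reg w r0; rewrite muB /=.
set B := qball dist w r in muB *; have mB : measurable B by exact: mball.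
set v := V r in V0 muB *.
pose f : T -> R := \1_B.
have mf : measurable_fun setT f by exact: measurable_indic.
have Nf : ('N[mu]_(p%:E)[EFin \o f] = (v `^ p^-1)%:E)%E.
  rewrite unlock (eq_integral (fun x => (f x)%:E)); last first.
    move=> x _; rewrite gee0_abs ?lee_fin//= /f indicE.
    by case: (x \in _); rewrite ?powR1 ?powR0// gt_eqF.
  by rewrite integral_indic// setIT muB poweR_EFin.
have fL : f \in Lfun mu p%:E.
  by apply/andP; split; rewrite inE//= /finite_norm Nf ltry.
pose m := bmean w r.
have int0 : (0 <= \int[mu]_(x in B) (`|b x - m| `^ q)%:E)%E.
  by apply: integral_ge0 => x _; rewrite lee_fin powR_ge0.
have low x : B x -> ((v `^ (alpha / Q%:R) * `|b x - m|)%:E <=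
    max_commutator mu dist Q alpha b f x)%E.
  move=> Bx; apply: ereal_sup_ge.
  exists (((fine (mu B) `^ (1 - alpha / Q%:R))^-1)%:E *
                 \int[mu]_(y in B) (`|b x - b y| * `|f y|)%:E)%E.
    by exists B => //; split => //; exists w, r.
  rewrite muB /=.
  have -> : (\int[mu]_(y in B) (`|b x - b y| * `|f y|)%:E =
      \int[mu]_(y in B) (`|b x - b y|)%:E)%E.
    by apply: eq_integral => y yB; rewrite /f indicE yB normr1 mulr1.
  case: (leP (+oo)%E (\int[mu]_(y in B) (`|b x - b y|)%:E)%E) => [|fin].
    rewrite leye_eq => /eqP ->; rewrite gt0_muley ?leey// lte_fin invr_gt0 powR_gt0//.
  have ge0 : (0 <= \int[mu]_(y in B) (`|b x - b y|)%:E)%E by apply: integral_ge0.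
  have finE : (\int[mu]_(y in B) (`|b x - b y|)%:E)%E \is a fin_num.
    by rewrite ge0_fin_numE.
  rewrite -(fineK finE) -EFinM lee_fin.
  have -> : v `^ (alpha / Q%:R) = (v `^ (1 - alpha / Q%:R))^-1 * v.
    rewrite -powRN -{3}[v]powRr1 ?(ltW V0)// -powRD ?(gt_eqF V0) ?implybT//.
    by rewrite opprB subrK.
  rewrite -mulrA ler_pM2l ?invr_gt0 ?powR_gt0// -ler_pdivlMl//.
  by apply: dev_mean_le => //; rewrite fineK.
have key : ((v `^ (alpha / Q%:R) `^ q)%:E * \int[mu]_(x in B) (`|b x - m| `^ q)%:E <=
    ((C * v `^ p^-1) `^ q)%:E)%E.
  rewrite -ge0_integralZl_EFin; [|exact: mB
    |by move=> x _; rewrite lee_fin powR_ge0|exact: measurable_dev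
    |exact: powR_ge0].
  apply: (@le_trans _ _ ('N[mu]_(q%:E)[max_commutator mu dist Q alpha b f] `^ q)%E).
    rewrite poweR_Lnorm ?gt_eqF// integral_mkcond; apply: le_integral_pointwise.
      by move=> x; rewrite erestrict_ge0// => y _; rewrite mule_ge0// lee_fin powR_ge0.
    move=> x; rewrite patchE; case: ifPn => [|_]; last exact: poweR_ge0.
    rewrite inE => Bx; rewrite -EFinM -powRM ?powR_ge0// -poweR_EFin.
    have dev0 : (0 <= (v `^ (alpha / Q%:R) * `|b x - m|)%:E)%E.
      by rewrite lee_fin mulr_ge0 ?powR_ge0.
    apply: gt0_ler_poweR; rewrite ?(ltW q0)//.
    - by rewrite in_itv/= leey dev0.
    - by rewrite in_itv/= leey abse_ge0.
    by apply: le_trans (lee_abs _); exact: low.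
  rewrite -poweR_EFin; apply: gt0_ler_poweR; rewrite ?(ltW q0)//.
  - by rewrite in_itv/= leey Lnorm_ge0.
  - by rewrite in_itv/= leey lee_fin mulr_ge0 ?powR_ge0// ltW.
  by apply: le_trans (bound _ fL) _; rewrite Nf EFinM.
have va0 : 0 < v `^ (alpha / Q%:R) `^ q by rewrite !powR_gt0.
have intle : (\int[mu]_(x in B) (`|b x - m| `^ q)%:E <=
    ((v `^ (alpha / Q%:R) `^ q)^-1 * (C * v `^ p^-1) `^ q)%:E)%E.
  by rewrite EFinM lee_pdivlMl.
apply: (@le_trans _ _ ((v `^ (beta / Q%:R))^-1%:E * (v^-1%:E *
    ((v `^ (alpha / Q%:R) `^ q)^-1 * (C * v `^ p^-1) `^ q)%:E) `^ q^-1)%E).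
  rewrite lee_wpmul2l ?lee_fin ?invr_ge0 ?powR_ge0//.
  have vi0 : 0 <= v^-1 by rewrite invr_ge0 ltW.
  apply: gt0_ler_poweR; rewrite ?invr_ge0 ?(ltW q0)//.
  - by rewrite in_itv/= leey mule_ge0.
  - by rewrite in_itv/= leey mule_ge0 ?lee_fin// mulr_ge0 ?powR_ge0// invr_ge0 powR_ge0.
  by rewrite lee_wpmul2l ?lee_fin.
rewrite (_ : v^-1%:E * _ = (v^-1 *
  ((v `^ (alpha / Q%:R) `^ q)^-1 * (C * v `^ p^-1) `^ q))%:E)%E//.
rewrite poweR_EFin -EFinM lee_fin le_eqVlt; apply/orP; left; apply/eqP.
set a := alpha / Q%:R; set e := beta / Q%:R.
have Cv0 : 0 <= C * v `^ p^-1 by rewrite mulr_ge0 ?powR_ge0// ltW.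
have root x : 0 <= x -> (x `^ q) `^ q^-1 = x.
  by move=> x0; rewrite -powRrM mulfV ?gt_eqF// powRr1.
have -> : (v^-1 * ((v `^ a `^ q)^-1 * (C * v `^ p^-1) `^ q)) `^ q^-1 =
    v `^ (- q^-1) * (v `^ (- a) * (C * v `^ p^-1)).
  have vi0 : 0 <= v^-1 by rewrite invr_ge0 ltW.
  have ai0 : 0 <= (v `^ a `^ q)^-1 by rewrite invr_ge0 powR_ge0.
  have Y0 : 0 <= (C * v `^ p^-1) `^ q by rewrite powR_ge0.
  rewrite (powRM _ vi0 (mulr_ge0 ai0 Y0)) (powRM _ ai0 Y0) root//.
  congr (_ * (_ * _)).
    by rewrite -powR_inv1 ?(ltW V0)// -powRrM mulN1r.
  by rewrite -powRN -!powRrM; congr (_ `^ _); field; rewrite gt_eqF.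
rewrite -powRN -[RHS]mulr1 -(powRr0 v).
have -> : 0 = - e + (- q^-1 + (- a + p^-1)) by rewrite qE /e /a; ring.
rewrite !powRD ?(gt_eqF V0) ?implybT//.
by ring.
Qed.


End MeanOscillation.

(** * The Lipschitz representative of a function of finite mean oscillation *)

Lemma pow_squeeze (R : realType) (a M r beta : R) : 0 < M -> 0 < r -> 0 < beta ->
  (forall e, 0 < e <= r -> a <= M * e `^ beta) -> a <= 0.
Proof.
move=> M0 r0 beta0 small; rewrite leNgt; apply/negP => a0.
pose e := Num.min r ((a / (2 * M)) `^ beta^-1).
have aM0 : 0 < a / (2 * M) by rewrite divr_gt0// mulr_gt0.
have e0 : 0 < e by rewrite lt_min r0 powR_gt0.
have /small : 0 < e <= r by rewrite e0 ge_min lexx.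
apply/negP; rewrite -ltNge; apply: (@le_lt_trans _ _ (M * (a / (2 * M)))).
  rewrite ler_pM2l//; apply: (@le_trans _ _ ((a / (2 * M)) `^ beta^-1 `^ beta)).
    apply: ge0_ler_powR; rewrite ?nnegrE ?powR_ge0 ?(ltW beta0) ?(ltW e0)//.
    by rewrite ge_min lexx orbT.
  by rewrite -powRrM mulVf ?gt_eqF// powRr1// ltW.
have -> : M * (a / (2 * M)) = a / 2 by field; rewrite gt_eqF.
by rewrite ltr_pdivrMr// ltr_pMr// ltr1n.
Qed.

Lemma integral_bigsetU_le d (T : measurableType d) (R : realType)
    (mu : {measure set T -> \bar R}) (I : Type) (F : I -> set T)
    (f : T -> \bar R) (s : seq I) :
  (forall i, measurable (F i)) -> measurable_fun setT f -> (forall x, 0 <= f x)%E ->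
  (\int[mu]_(x in \big[setU/set0]_(i <- s) F i) f x <=
   \sum_(i <- s) \int[mu]_(x in F i) f x)%E.
Proof.
move=> mF mf f0; elim: s => [|i s IH]; first by rewrite !big_nil integral_set0.
rewrite !big_cons; set U := \big[setU/set0]_(j <- s) F j in IH *.
have mU : measurable U by exact: bigsetU_measurable.
have -> : F i `|` U = F i `|` (U `\` F i).
  apply/seteqP; split=> x [Fx|]; [by left| |by left|by move=> [Ux _]; right].
  by move=> Ux; have [Fx|Fx] := pselect (F i x); [left|right].
rewrite ge0_integral_setU//; last 3 first.
- exact: measurableD.
- exact: measurable_funTS.
- by rewrite disj_set2E; apply/eqP/seteqP; split => // x [? []].
apply: leeD => //; apply: le_trans IH.
by apply: ge0_subset_integral => //; [exact: measurableD|exact: measurable_funTS].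
Qed.

Section CampanatoToLipschitz.
Context d (T : measurableType d) (R : realType).
Variables (mu : {measure set T -> \bar R}) (dist : T -> T -> R).
Variables (Q : nat) (c0 c1 : R).
Hypothesis reg : ahlfors_regular mu dist Q c0 c1.

Let mball x r : measurable (qball dist x r) := measurable_qball reg x r.

Let c0_gt0 : 0 < c0. Proof. exact: lt_le_trans ltr01 (quasi_ge1 reg). Qed.

Let c1_gt0 : 0 < c1. Proof. exact: volume_gt0 reg. Qed.

Notation V := (qball_volume Q c1).

(** A superlevel set of f is the union of the balls with centre in z and
    rational radius that it contains. *)
Lemma measurable_lipschitz (z : nat -> T) (f : T -> R) (L beta : R) :
  dense_seq dist z -> 0 < L -> 0 < beta ->
  (forall x y, `|f x - f y| <= L * dist x y `^ beta) -> measurable_fun setT f.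
Proof.
move=> zdense L0 beta0 lip.
move=> mT; apply: (measurability _ (RGenOInfty.measurableE R)) => //.
move=> /= _ [_ [a ->] <-]; rewrite preimage_itvoy setTI.
pose S := [set x | a < f x].
pose F n : set T := if unpickle n is Some (k, q) then
  (if `[< qball dist (z k) (ratr q) `<=` S >] then qball dist (z k) (ratr q)
   else set0) else set0.
rewrite (_ : [set x | _] = \bigcup_n F n); last first.
  apply/seteqP; split => x /=; last first.
    move=> [n _]; rewrite /F; case: unpickle => // -[k q].
    by case: asboolP => // h /h.
  move=> ax; pose rho := ((f x - a) / (2 * L)) `^ beta^-1.
  have fxa : 0 < (f x - a) / (2 * L) by rewrite divr_gt0 ?subr_gt0// mulr_gt0.
  have rho0 : 0 < rho by rewrite powR_gt0.
  (* A ball of radius between dl and 2 dl around a point within dl of x lies in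
     the ball of centre x and radius 3 c0 dl = rho. *)
  have dl0 : 0 < rho / (3 * c0) by rewrite divr_gt0// mulr_gt0.
  set dl := rho / (3 * c0) in dl0.
  have [k xk] := zdense x _ dl0.
  have /rat_in_itvoo[q] : dl < 2 * dl by rewrite ltr_pMl// ltr1n.
  rewrite in_itv/= => /andP[q1 q2].
  exists (pickle (k, q)) => //; rewrite /F pickleK; case: asboolP => [_|].
    by rewrite /qball/= (dist_sym reg); exact: lt_trans q1.
  case=> y kqy; have := qball_tri reg xk (lt_trans kqy q2).
  have -> : c0 * (dl + 2 * dl) = rho by rewrite /dl; field; rewrite gt_eqF.
  move=> xy; have : f x - f y < f x - a.
    apply: le_lt_trans (ler_norm _) _; apply: le_lt_trans (lip _ _) _.
    apply: (@le_lt_trans _ _ (L * rho `^ beta)).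
      rewrite ler_pM2l//; apply: ge0_ler_powR;
        rewrite ?nnegrE ?(ltW beta0) ?(ltW rho0) ?(ltW xy)//.
      exact: dist_ge0 reg _ _.
    rewrite /rho -powRrM mulVf ?gt_eqF// powRr1 ?(ltW fxa)//.
    have -> : L * ((f x - a) / (2 * L)) = (f x - a) / 2 by field; rewrite gt_eqF.
    by rewrite ltr_pdivrMr// ltr_pMr ?ltr1n// subr_gt0.
  by rewrite ltrD2l ltrN2.
apply: bigcupT_measurable => n; rewrite /F; case: unpickle => // -[k q].
by case: asboolP.
Qed.

Variable b : T -> R.
Hypothesis mb : measurable_fun setT b.
Hypothesis ib : forall w r, mu.-integrable (qball dist w r) (EFin \o b).

Notation bmean w r := (ball_mean mu b (qball dist w r)).

Variable beta : R.
Hypothesis beta0 : 0 < beta.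

(** With A = K |B|^(beta/Q), one has t <= A + A^(1-s) t^s for t >= 0, and the
    integral of |b - b_B|^s is at most |B| A^s. *)
Lemma campanato_osc (s K : R) w r : 1 <= s -> 0 < K -> 0 < r ->
  (campanato_quotient mu Q b beta s (qball dist w r) <= K%:E)%E ->
  (\int[mu]_(x in qball dist w r) (`|bmean w r - b x|)%:E <=
     (2 * K * c1 `^ (beta / Q%:R) * r `^ beta * V r)%:E)%E.
Proof.
move=> s1 K0 r0; have s0 : 0 < s by apply: lt_le_trans s1.
have V0 := qball_volume_gt0 reg r0.
rewrite /campanato_quotient; have muB := measure_qball_volume reg w r0; rewrite muB /=.
set B := qball dist w r in muB *; have mB : measurable B by exact: mball.
set v := V r in V0 muB *; set m := bmean w r.
pose A := K * v `^ (beta / Q%:R).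
have A0 : 0 < A by rewrite mulr_gt0// powR_gt0.
have int0 : (0 <= \int[mu]_(x in B) (`|b x - m| `^ s)%:E)%E.
  by apply: integral_ge0 => x _; rewrite lee_fin powR_ge0.
(* The hypothesis says that the s-th root of the mean of |b - b_B|^s is at most A. *)
rewrite lee_pdivrMl ?powR_gt0// -EFinM mulrC -/A => quo.
have intle : (\int[mu]_(x in B) (`|b x - m| `^ s)%:E <= (v * A `^ s)%:E)%E.
  rewrite EFinM -lee_pdivrMl// -poweR_EFin.
  set J := (_ * _)%E in quo *.
  have J0 : (0 <= J)%E by rewrite mule_ge0// lee_fin invr_ge0 ltW.
  have -> : J = ((J `^ s^-1) `^ s)%E by rewrite -poweRrM mulVf ?gt_eqF// poweRe1.
  apply: gt0_ler_poweR; rewrite ?(ltW s0)//.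
    by rewrite in_itv/= leey poweR_ge0.
  by rewrite in_itv/= leey lee_fin ltW.
have -> : 2 * K * c1 `^ (beta / Q%:R) * r `^ beta * v =
    A * v + A `^ (1 - s) * (v * A `^ s).
  have -> : A `^ (1 - s) * (v * A `^ s) = A * v.
    by rewrite mulrCA -powRD ?(gt_eqF A0) ?implybT// subrK powRr1 ?(ltW A0)// mulrC.
  rewrite (radius_powE reg _ r0) -/v.
  have cc : c1 `^ (beta / Q%:R) * c1^-1 `^ (beta / Q%:R) = 1.
    by rewrite -powRM ?invr_ge0 ?(ltW c1_gt0)// mulfV ?gt_eqF// powR1.
  rewrite /A; transitivity (2 * K * (c1 `^ (beta / Q%:R) * c1^-1 `^ (beta / Q%:R)) *
      v `^ (beta / Q%:R) * v); first by ring.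
  by rewrite cc; ring.
rewrite EFinD [(A `^ _ * _)%:E]EFinM.
apply: (@le_trans _ _ (\int[mu]_(x in B)
    (cst A%:E x + (A `^ (1 - s))%:E * (`|b x - m| `^ s)%:E))%E).
  apply: ge0_le_integral => //.
  - apply/measurable_EFinP; apply: measurable_funTS; apply: measurableT_comp => //.
    exact: measurable_funB.
  - apply: emeasurable_funD; first exact: measurable_cst.
    by apply: measurable_funeM; exact: measurable_dev.
  move=> x _; rewrite /= -EFinM -EFinD lee_fin distrC; set t := `|b x - m|.
  have t0 : 0 <= t by exact: normr_ge0.
  have [tA|At] := leP t A.
    by apply: le_trans tA _; rewrite lerDl mulr_ge0 ?powR_ge0.
  have -> : A `^ (1 - s) * t `^ s = A * (t / A) `^ s.
    have Ai0 : 0 <= A^-1 by rewrite invr_ge0 ltW.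
    rewrite (powRM s t0 Ai0) powRD ?(gt_eqF A0) ?implybT//.
    rewrite powRr1 ?(ltW A0)// -[A^-1]powR_inv1 ?(ltW A0)// -powRrM mulN1r.
    by ring.
  apply: le_trans (_ : A * (t / A) `^ s <= _); last by rewrite lerDr ltW.
  rewrite -ler_pdivrMl// mulrC; apply: le1r_powR => //.
  by rewrite ler_pdivlMr// mul1r ltW.
rewrite ge0_integralD//; last 3 first.
- by move=> x _; rewrite lee_fin ltW.
- by move=> x _; rewrite mule_ge0 ?lee_fin ?powR_ge0.
- by apply: measurable_funeM; exact: measurable_dev.
apply: leeD; first by rewrite integral_cst// muB EFinM.
rewrite ge0_integralZl_EFin; [|exact: mB
    |by move=> x _; rewrite lee_fin powR_ge0|exact: measurable_dev
    |exact: powR_ge0].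
by rewrite lee_wpmul2l ?lee_fin ?powR_ge0.
Qed.

Section LipschitzRepresentative.
Variable D : R.
Hypothesis D0 : 0 < D.
Hypothesis osc : forall w r, 0 < r ->
  (\int[mu]_(x in qball dist w r) (`|bmean w r - b x|)%:E <=
     (D * r `^ beta * V r)%:E)%E.

Let G k := k ^+ Q * D * k `^ beta.

Let G_gt0 k : 0 < k -> 0 < G k.
Proof. by move=> k0; rewrite !mulr_gt0 ?exprn_gt0 ?powR_gt0. Qed.

(** The deviation of b from its mean on the larger ball, integrated over the
    smaller one, is at most its integral over the larger one; dividing by the
    smaller volume costs the ratio k^Q of the volumes. *)
Lemma mean_nested k x r w r' : 0 < k -> 0 < r -> 0 < r' <= k * r ->
  qball dist x r `<=` qball dist w r' ->
  `|bmean w r' - bmean x r| <= G k * r `^ beta.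
Proof.
move=> k0 r0 /andP[r'0 r'k] sub.
have V0 := qball_volume_gt0 reg r0.
apply: le_trans (dev_mean_le reg ib (X := D * r' `^ beta * V r') r0 _) _.
  apply: le_trans (osc w r'0); apply: ge0_subset_integral => //.
  apply/measurable_EFinP; apply: measurable_funTS; apply: measurableT_comp => //.
  exact: measurable_funB.
rewrite ler_pdivrMl//.
have Vk : V r' <= k ^+ Q * V r.
  rewrite /qball_volume mulrCA ler_pM2l// -exprMn.
  by rewrite lerXn2r// nnegrE ltW// mulr_gt0.
have rk : r' `^ beta <= k `^ beta * r `^ beta.
  rewrite -powRM ?(ltW k0) ?(ltW r0)//; apply: ge0_ler_powR;
    rewrite ?nnegrE ?(ltW beta0) ?(ltW r'0)//.
  by rewrite ltW// mulr_gt0.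
apply: (@le_trans _ _ (D * (k `^ beta * r `^ beta) * (k ^+ Q * V r))).
  apply: ler_pM => //; first by rewrite mulr_ge0 ?powR_ge0 ?(ltW D0).
    exact: ltW (qball_volume_gt0 reg r'0).
  by rewrite ler_pM2l.
by rewrite le_eqVlt; apply/orP; left; apply/eqP; rewrite /G; ring.
Qed.

Let u : R := 2 `^ (- beta).
Let u_lt1 : u < 1. Proof. exact: pow2N_lt1. Qed.
Let w_gt0 : 0 < 1 - u. Proof. by rewrite subr_gt0. Qed.
Let E := G 2 / (1 - u).
Let E_gt0 : 0 < E. Proof. by rewrite divr_gt0// G_gt0. Qed.

(** The radius is halved until it reaches the order of s; the errors form a
    geometric progression of ratio u = 2^-beta, of which E is the sum. *)
Lemma mean_dyadic n x r s : 0 < r -> r / 2 ^+ n <= s <= r ->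
  `|bmean x r - bmean x s| <= E * r `^ beta.
Proof.
elim: n r => [|n IH] r r0 /andP[rs sr].
  have -> : s = r by apply/eqP; rewrite eq_le sr -[leLHS]divr1.
  by rewrite subrr normr0 mulr_ge0 ?powR_ge0// ltW.
have s0 : 0 < s by apply: lt_le_trans rs; rewrite divr_gt0// exprn_gt0.
have G2E : G 2 <= E.
  rewrite /E ler_pdivlMr// ler_piMr ?(ltW (G_gt0 _))//.
  by rewrite gerBl powR_ge0.
have rb : 0 <= r `^ beta by exact: powR_ge0.
have [r2s|sr2] := leP (r / 2) s.
  apply: (@le_trans _ _ (G 2 * s `^ beta)).
    apply: mean_nested => //; first by rewrite r0 mulrC -ler_pdivrMr.
    by move=> y /lt_le_trans; exact.
  rewrite ler_pM ?powR_ge0 ?(ltW (G_gt0 _))//.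
  by apply: ge0_ler_powR; rewrite ?nnegrE ?(ltW beta0) ?(ltW s0) ?(ltW r0).
have r20 : 0 < r / 2 by rewrite divr_gt0.
have -> : bmean x r - bmean x s =
  (bmean x r - bmean x (r / 2)) + (bmean x (r / 2) - bmean x s) by ring.
have r2b : (r / 2) `^ beta = u * r `^ beta.
  rewrite powRM ?(ltW r0)// mulrC; congr (_ * _).
  by rewrite /u -[2^-1]powR_inv1// -powRrM mulN1r.
apply: le_trans (ler_normD _ _) _.
apply: (@le_trans _ _ (G 2 * r `^ beta + E * (u * r `^ beta))).
  apply: lerD.
    apply: (@le_trans _ _ (G 2 * (r / 2) `^ beta)).
      apply: mean_nested => //; first by rewrite r0/=; lra.
      by move=> y /lt_le_trans; apply; rewrite ler_pdivrMr// ler_pMr// ler1n.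
    rewrite ler_pM2l ?G_gt0// r2b ler_piMl// ltW//.
  rewrite -r2b; apply: IH => //; rewrite (ltW sr2) andbT.
  by apply: le_trans rs; rewrite exprS invfM mulrA.
rewrite le_eqVlt; apply/orP; left; apply/eqP; rewrite /E; field.
by rewrite gt_eqF.
Qed.

Lemma mean_compare x r s : 0 < r -> 0 < s ->
  bmean x r - E * r `^ beta <= bmean x s + E * s `^ beta.
Proof.
have main r' s' : 0 < r' -> 0 < s' -> s' <= r' ->
    `|bmean x r' - bmean x s'| <= E * r' `^ beta.
  move=> r0 s0 sr; have := nbhs_infty_ger (r' / s') => -[n _ /(_ n (leqnn n)) nrs].
  apply: (@mean_dyadic n) => //; rewrite sr andbT.
  rewrite ler_pdivrMr ?exprn_gt0// mulrC -ler_pdivrMr//.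
  by apply: le_trans nrs _; rewrite -natrX ler_nat ltnW// ltn_expl.
move=> r0 s0; have Er t : 0 <= E * t `^ beta by rewrite mulr_ge0 ?powR_ge0// ltW.
have [sr|rs] := leP s r.
  have := main _ _ r0 s0 sr; have := Er s.
  by rewrite ler_norml => ? /andP[? ?]; lra.
have := main _ _ s0 r0 (ltW rs); have := Er r.
by rewrite ler_norml => ? /andP[? ?]; lra.
Qed.

(** The limit of the means of b on B(x, r) as r tends to 0. The intervals of
    centre bmean x r and half-length E r^beta meet pairwise, by
    [mean_compare]; the supremum of their left ends lies in all of them, which
    gives the limit together with the rate of convergence. *)
Definition regularization (x : T) : R :=
  sup [set bmean x r - E * r `^ beta | r in [set r | 0 < r]].

Lemma regularization_mean x r : 0 < r ->
  `|regularization x - bmean x r| <= E * r `^ beta.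
Proof.
move=> r0; set S := [set bmean x r - E * r `^ beta | r in [set r | 0 < r]].
have ubS s : 0 < s -> ubound S (bmean x s + E * s `^ beta).
  by move=> s0 _ [t t0 <-]; exact: mean_compare.
have hS : has_sup S.
  split; first by exists (bmean x 1 - E * 1 `^ beta), 1 => //=.
  by exists (bmean x 1 + E * 1 `^ beta); exact: ubS.
have h1 : regularization x <= bmean x r + E * r `^ beta.
  by apply: ge_sup (ubS _ r0); case: hS.
have h2 : bmean x r - E * r `^ beta <= regularization x.
  by apply: sup_upper_bound => //; exists r.
rewrite ler_norml; apply/andP; split; lra.
Qed.

Let k2 := 2 * c0.
Let k2_gt0 : 0 < k2. Proof. by rewrite mulr_gt0. Qed.

Lemma qball_sub_swap x y r : dist x y < r -> qball dist x r `<=` qball dist y (k2 * r).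
Proof.
move=> xy w xw; rewrite (dist_sym reg) in xy.
by have := qball_tri reg xy xw; rewrite /qball/=; congr (_ < _); rewrite /k2; ring.
Qed.

Let H := E + G k2 + E * k2 `^ beta.
Let H_gt0 : 0 < H.
Proof. by rewrite !addr_gt0 ?G_gt0// mulr_gt0// powR_gt0. Qed.

Lemma regularization_lt x y r : dist x y < r ->
  `|regularization x - regularization y| <= H * r `^ beta.
Proof.
move=> xy; have r0 : 0 < r by apply: le_lt_trans xy; exact: dist_ge0 reg _ _.
have kr0 : 0 < k2 * r by rewrite mulr_gt0.
have h1 := regularization_mean x r0.
have h2 := regularization_mean y kr0.
have h3 : `|bmean y (k2 * r) - bmean x r| <= G k2 * r `^ beta.
  by apply: mean_nested => //; [rewrite kr0 lexx|exact: qball_sub_swap].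
have kb : (k2 * r) `^ beta = k2 `^ beta * r `^ beta.
  by rewrite powRM ?(ltW k2_gt0) ?(ltW r0).
have -> : H * r `^ beta = E * r `^ beta + G k2 * r `^ beta + E * (k2 * r) `^ beta.
  by rewrite kb /H; ring.
have -> : regularization x - regularization y = (regularization x - bmean x r) -
  (bmean y (k2 * r) - bmean x r) - (regularization y - bmean y (k2 * r)) by ring.
apply: le_trans (ler_normB _ _) _; apply: lerD => //.
by apply: le_trans (ler_normB _ _) _; apply: lerD.
Qed.

(** The bound by any r > dist x y suffices: r = 2 dist x y if the distance is
    positive; if x and y are at distance 0, then r is arbitrarily small. *)
Lemma regularization_lipschitz x y :
  `|regularization x - regularization y| <= H * 2 `^ beta * dist x y `^ beta.
Proof.
have [xy0|xy0] := eqVneq (dist x y) 0.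
  rewrite xy0 powR0 ?mulr0 ?gt_eqF//.
  apply: (@pow_squeeze _ _ H 1 beta) => // e /andP[e0 _].
  by apply: regularization_lt; rewrite xy0.
have xy : 0 < dist x y by rewrite lt_neqAle eq_sym xy0; exact: dist_ge0 reg _ _.
rewrite -mulrA -powRM ?(ltW xy)//; apply: regularization_lt.
by rewrite ltr_pMl// ltr1n.
Qed.

Variable z : nat -> T.
Hypothesis zdense : dense_seq dist z.

Lemma measurable_regularization : measurable_fun setT regularization.
Proof.
apply: measurable_lipschitz zdense _ beta0 regularization_lipschitz.
by rewrite mulr_gt0// powR_gt0.
Qed.

Lemma regularization_near w r x : qball dist w r x ->
  `|regularization x - bmean w r| <= (E + 2 * G k2) * r `^ beta.
Proof.
move=> wx; have r0 : 0 < r by apply: le_lt_trans wx; exact: dist_ge0 reg _ _.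
have kr0 : 0 < k2 * r by rewrite mulr_gt0.
have xw : dist x w < r by rewrite (dist_sym reg).
have h1 := regularization_mean x r0.
have h2 : `|bmean w (k2 * r) - bmean x r| <= G k2 * r `^ beta.
  by apply: mean_nested => //; [rewrite kr0 lexx|exact: qball_sub_swap].
have h3 : `|bmean w (k2 * r) - bmean w r| <= G k2 * r `^ beta.
  apply: mean_nested => //; first by rewrite kr0 lexx.
  by apply: qball_sub_swap; rewrite (distxx reg).
have -> : (E + 2 * G k2) * r `^ beta =
  E * r `^ beta + G k2 * r `^ beta + G k2 * r `^ beta by ring.
have -> : regularization x - bmean w r = (regularization x - bmean x r) -
  (bmean w (k2 * r) - bmean x r) + (bmean w (k2 * r) - bmean w r) by ring.
apply: le_trans (ler_normD _ _) _; apply: lerD => //.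
by apply: le_trans (ler_normB _ _) _; apply: lerD.
Qed.

Let h x := `|regularization x - b x|.
Let mh (A : set T) : measurable_fun A (fun x => (h x)%:E).
Proof.
apply: measurable_funTS; apply/measurable_EFinP; apply: measurableT_comp => //.
by apply: measurable_funB => //; exact: measurable_regularization.
Qed.

Let J := D + (E + 2 * G k2).
Let J_gt0 : 0 < J.
Proof. by rewrite !addr_gt0// mulr_gt0// G_gt0. Qed.

Lemma integral_regularization_le w r : 0 < r ->
  (\int[mu]_(x in qball dist w r) (h x)%:E <= (J * r `^ beta * V r)%:E)%E.
Proof.
move=> r0; have muB := measure_qball_volume reg w r0.
set o := (E + 2 * G k2) * r `^ beta.
have o0 : 0 <= o by rewrite mulr_ge0 ?powR_ge0// ltW// addr_gt0// mulr_gt0// G_gt0.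
have mdb A : measurable_fun A (fun x => (`|bmean w r - b x|)%:E).
  apply: measurable_funTS; apply/measurable_EFinP; apply: measurableT_comp => //.
  exact: measurable_funB.
apply: (@le_trans _ _ (\int[mu]_(x in qball dist w r)
    ((`|bmean w r - b x|)%:E + cst o%:E x))%E).
  apply: ge0_le_integral => //.
  - by move=> x _; rewrite lee_fin normr_ge0.
  - by apply: emeasurable_funD => //; exact: measurable_cst.
  move=> x wx; rewrite /= -EFinD lee_fin /h.
  have -> : regularization x - b x =
      (bmean w r - b x) + (regularization x - bmean w r) by ring.
  by apply: le_trans (ler_normD _ _) _; rewrite lerD2l; exact: regularization_near.
rewrite ge0_integralD//.
rewrite integral_cst// muB.
apply: le_trans (leeD2r _ (osc w r0)) _.
rewrite -EFinM -EFinD lee_fin le_eqVlt; apply/orP; left; apply/eqP.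
by rewrite /J /o; ring.
Qed.

(** The ball is covered by at most (4 c0^2 r / e)^Q balls of radius e, on each
    of which the integral is O(e^beta e^Q). *)
Lemma integral_regularization0 w r : 0 < r ->
  (\int[mu]_(x in qball dist w r) (h x)%:E = 0)%E.
Proof.
move=> r0; set I := (\int[mu]_(x in qball dist w r) (h x)%:E)%E.
have I0 : (0 <= I)%E by apply: integral_ge0 => x _; rewrite lee_fin normr_ge0.
pose M := J * c1 * (4 * c0 ^+ 2 * r) ^+ Q.
have M0 : 0 < M by rewrite !mulr_gt0// exprn_gt0// !mulr_gt0// exprn_gt0.
have small e : 0 < e <= r -> (I <= (M * e `^ beta)%:E)%E.
  move=> er; have [s [ss sub]] := cover_qball reg w er.
  have /andP[e0 _] := er.
  apply: (@le_trans _ _ (\int[mu]_(x in \big[setU/set0]_(i <- s) qball dist i e)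
      (h x)%:E)%E).
    apply: ge0_subset_integral => //; first exact: bigsetU_measurable.
      by move=> x _; rewrite lee_fin normr_ge0.
    by rewrite -bigcup_seq.
  apply: (@le_trans _ _ (((size s)%:R * (J * e `^ beta * V e))%:E)).
    apply: le_trans (integral_bigsetU_le _ _ _ _ _) _ => //.
      by move=> x; rewrite lee_fin normr_ge0.
    apply: (@le_trans _ _ (\sum_(i <- s) (J * e `^ beta * V e)%:E)%E).
      by apply: lee_sum => i _; exact: integral_regularization_le.
    by rewrite sumEFin big_const_seq count_predT iter_addr_0 mulr_natl.
  rewrite lee_fin /qball_volume.
  have -> : (size s)%:R * (J * e `^ beta * (c1 * e ^+ Q)) =
    J * c1 * ((size s)%:R * e ^+ Q) * e `^ beta by ring.
  rewrite ler_wpM2r ?powR_ge0// ler_pM2l// mulr_gt0//.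
have Ifin : I \is a fin_num.
  by rewrite ge0_fin_numE// (le_lt_trans (small r _)) ?ltry// r0 lexx.
apply/eqP; rewrite eq_le I0 andbT -(fineK Ifin) lee_fin.
apply: (@pow_squeeze _ _ M r beta) => // e /small.
by rewrite -{1}(fineK Ifin) lee_fin.
Qed.

Lemma regularization_ae : {ae mu, forall x, b x = regularization x}.
Proof.
have ball n : {ae mu, forall x, qball dist (z 0) n.+1%:R x ->
    (regularization x - b x)%:E = 0}.
  have mD A : measurable_fun A (fun x => (regularization x - b x)%:E).
    apply: measurable_funTS; apply/measurable_EFinP.
    by apply: measurable_funB => //; exact: measurable_regularization.
  apply/(ae_eq_integral_abs mu (mball (z 0) n.+1%:R) (mD _)).
  exact: integral_regularization0.
apply: filterS (ae_foralln ball) => x hx.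
have := nbhs_infty_ger (dist (z 0) x) => -[n _ /(_ n (leqnn n)) nx].
have /hx : qball dist (z 0) n.+1%:R x by apply: le_lt_trans nx _; rewrite ltr_nat.
by move=> /eqP; rewrite eqe subr_eq0 => /eqP.
Qed.

Lemma lipschitz_representative : exists2 b' : T -> R,
  (exists2 L : R, 0 < L & forall x y, `|b' x - b' y| <= L * dist x y `^ beta) &
  {ae mu, forall x, b x = b' x}.
Proof.
exists regularization; last exact: regularization_ae.
exists (H * 2 `^ beta); last exact: regularization_lipschitz.
by rewrite mulr_gt0// powR_gt0.
Qed.

End LipschitzRepresentative.
End CampanatoToLipschitz.

(** * Stratified groups as Ahlfors regular spaces *)

Section StratifiedGroup.
Context (R : realType) (G : stratifiedGroup R).
Variables (mu : {measure set (borel G) -> \bar R}) (rho : G -> R).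
Hypothesis haar : bi_invariant_haar mu.
Hypothesis hnorm : homogeneous_norm rho.

Definition gdist (x y : borel G) : R := rho ((y : G)^-1 * x)%g.

Lemma measurable_open (U : set G) : open U -> measurable (U : set (borel G)).
Proof. by move=> oU; apply: sub_sigma_algebra. Qed.

Lemma lmul_continuous (a : G) : continuous (fun x : G => (a * x)%g).
Proof.
move=> x; apply: (@continuous_comp _ _ _ (fun y : G => (a, y))
    (fun u : G * G => (u.1 * u.2)%g)).
  by apply: cvg_pair => //=; exact: cvg_cst.
exact: mulg_continuous.
Qed.

Lemma gball_open x r : open (gball rho x r).
Proof.
have c : continuous (fun y : G => rho (y^-1 * x)%g).
  move=> y; apply: (@continuous_comp _ _ _ (fun y : G => (y^-1 * x)%g) rho).
    apply: (@continuous_comp _ _ _ (fun y : G => (y^-1%g, x))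
    (fun u : G * G => (u.1 * u.2)%g)).
      by apply: cvg_pair => //; [exact: invg_continuous|exact: cvg_cst].
    exact: mulg_continuous.
  exact: hnorm_continuous.
exact: ((continuousP _).1 c _ (@open_lt _ r)).
Qed.

Lemma gball_center x r : 0 < r -> gball rho x r x.
Proof. by move=> r0; rewrite /gball/= mulVg (hnorm1 hnorm). Qed.

Lemma gdist_regular c0 c1 : 1 <= c0 ->
  (forall x y, rho (x * y)%g <= c0 * (rho x + rho y)) ->
  0 < c1 -> (0 < hom_dim G)%N ->
  (forall x r, 0 < r -> mu (gball rho x r) = (c1 * r ^+ hom_dim G)%:E) ->
  ahlfors_regular mu gdist (hom_dim G) c0 c1.
Proof.
move=> c01 tri c10 Q0 vol; split => //.
- by move=> x y; exact: hnorm_ge0 hnorm _.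
- by move=> x; rewrite /gdist mulVg (hnorm1 hnorm).
- by move=> x y; rewrite /gdist -(hnorm_inv hnorm) invgM invgK.
- move=> x y z; rewrite /gdist addrC.
  by have := tri (z^-1 * y)%g (y^-1 * x)%g; rewrite mulgA mulgK.
- by move=> x r; apply: measurable_open; exact: gball_open.
Qed.

Lemma gdist_dense : exists z : nat -> borel G, dense_seq gdist z.
Proof.
have [B /countable_injP[f finj] [_ basisB]] := lie_second_countable (sg_lie G).
have /choice[z zP] : forall n, exists y : G, forall U, B U -> f U = n ->
    U !=set0 -> U y.
  move=> n; have [[U [BU fU [y Uy]]]|none] :=
    pselect (exists U, [/\ B U, f U = n & U !=set0]).
    exists y => W BW fW _; suff -> : W = U by [].
    by apply: finj; rewrite ?inE// fW.
  exists point => U BU fU U0; exfalso; apply: none; by exists U.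
exists z => x r r0; have nx : nbhs (x : G) (gball rho x r).
  by apply: open_nbhs_nbhs; split; [exact: gball_open|exact: gball_center].
have [U [BU Ux] Usub] := basisB x _ nx.
exists (f U); have : U (z (f U)) by apply: zP => //; exists x.
by move=> /Usub.
Qed.

Lemma compact_measurable_group (K : set G) : compact K ->
  measurable (K : set (borel G)).
Proof.
move=> cK; rewrite -(setCK (K : set (borel G))); apply: measurableC.
apply: measurable_open; rewrite openC.
exact: compact_closed (lie_hausdorff (sg_lie G)) cK.
Qed.

(** The ball is covered by finitely many translates of a compact set. Let W be
    the image under the exponential of a small ball of the Lie algebra. The
    translates of W by points of the ball have the same positive measure and
    lie in a larger ball of finite measure, so a maximal disjoint family of
    them is finite; each point of the ball lies in y W W^-1 for some y of this
    family. *)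
Lemma gball_relatively_compact c0 c1 x r :
  ahlfors_regular mu gdist (hom_dim G) c0 c1 ->
  exists2 K : set G, compact K & gball rho x r `<=` K.
Proof.
move=> reg.
pose e1 := @sg_exp _ G; pose l1 := @sg_log _ G.
have ec : continuous e1 := diffeo_exp_continuous (sg_diffeo G).
have lc : continuous l1 := diffeo_log_continuous (sg_diffeo G).
have eK : cancel e1 l1 := diffeo_expK (sg_diffeo G).
have lK : cancel l1 e1 := diffeo_logK (sg_diffeo G).
have e10 : e1 0 = 1%g := (sg_exponential G).1.
have rc : continuous (rho \o e1).
  by move=> v; apply: continuous_comp; [exact: ec|exact: hnorm_continuous].
have : nbhs (0 : 'rV[R]_(sg_dim G)) [set v | rho (e1 v) < 1].
  apply: open_nbhs_nbhs; split; last by rewrite /= e10 (hnorm1 hnorm).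
  exact: ((continuousP _).1 rc _ (@open_lt _ 1)).
move=> /nbhs_ballP[e /= e0 esub].
pose W := [set g : G | ball (0 : 'rV[R]_(sg_dim G)) e (l1 g)].
have oW : open W.
  by apply: ((continuousP _).1 lc); exact: ball_open.
have W1 : W 1%g by rewrite /W/= -e10 eK; exact: ballxx.
have Wrho g : W g -> rho g < 1.
  by move=> /esub /=; rewrite lK.
have [r0|r0] := leP r 0.
  exists set0; first exact: compact0.
  by move=> y; rewrite /gball/= ltNge (le_trans r0)//; exact: hnorm_ge0 hnorm _.
have mW : measurable (W : set (borel G)) by exact: measurable_open.
have muWfin : (mu W < +oo)%E.
  apply: le_lt_trans (_ : mu (qball gdist 1%g 1) < +oo)%E.
    apply: le_measure; rewrite ?inE//; first exact: measurable_qball reg _ _.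
    by move=> g /Wrho; rewrite /qball/= /gdist mulg1 (hnorm_inv hnorm).
  by rewrite (measure_qball reg)// ltry.
have muW0 : (0 < mu W)%E by apply: (haar_open haar) => //; exists 1%g.
have muWE : (mu W = (fine (mu W))%:E)%E by rewrite fineK// ge0_fin_numE.
have c01 := quasi_ge1 reg.
have r'0 : 0 < c0 * (r + 1).
  by rewrite mulr_gt0// ?addr_gt0//; exact: lt_le_trans c01.
pose W' (y : borel G) : set (borel G) := [set (y * g : G)%g | g in (W : set G)].
have [|||y xy|s [_ _ sc]] := @maximal_packing _ _ _ mu (qball gdist x r)
    (qball gdist x (c0 * (r + 1))) W' (fine (mu W)) (c1 * (c0 * (r + 1)) ^+ hom_dim G).
- by rewrite fine_gt0// muW0.
- exact: measurable_qball reg _ _.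
- by rewrite (measure_qball reg).
- split.
  + apply: measurable_open.
    rewrite (_ : W' y = (fun h : G => (y : G)^-1 * h)%g @^-1` W).
      by apply: ((continuousP _).1 (@lmul_continuous (y : G)^-1%g)).
    apply/seteqP; split => h /=; first by move=> [g Wg <-]; rewrite mulKg.
    by move=> Wh; exists ((y : G)^-1 * h)%g => //; rewrite mulVKg.
  + by rewrite -muWE -(haar_left haar y mW).
  + move=> _ [g Wg <-]; apply: (qball_tri reg xy).
    by rewrite /gdist invgM -mulgA mulVg mulg1 (hnorm_inv hnorm); exact: Wrho.
pose cb := closed_ball (0 : 'rV[R]_(sg_dim G)) e.
have ccb : compact (e1 @` cb).
  apply: continuous_compact; first exact: continuous_subspaceT.
  apply: bounded_closed_compact; last exact: closed_ball_closed.
  exists e; split; first exact: num_real.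
  move=> t et v; rewrite /cb closed_ballE// /closed_ball_/= sub0r normrN => ve.
  exact: le_trans ve (ltW et).
pose K0 : set G := (fun u : G * G => u.1 * u.2^-1)%g @` ((e1 @` cb) `*` (e1 @` cb)).
have cK0 : compact K0.
  apply: continuous_compact; last exact: compact_setX.
  apply: continuous_subspaceT => u.
  apply: (@continuous_comp _ _ _ (fun u : G * G => (u.1, u.2^-1)%g)
    (fun u : G * G => (u.1 * u.2)%g)).
    apply: cvg_pair => /=; first exact: cvg_fst.
    apply: (@continuous_comp _ _ _ (fun u : G * G => u.2) (fun x : G => (x^-1)%g)).
      exact: cvg_snd.
    exact: invg_continuous.
  exact: mulg_continuous.
exists (\big[setU/set0]_(y <- s) [set (y * k : G)%g | k in K0]).
  apply: bigsetU_compact => y _; apply: continuous_compact => //.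
  by apply: continuous_subspaceT; exact: lmul_continuous.
move=> y xy; have [y' y's [h [[g Wg gh] [g' Wg' gh']]]] := sc _ xy.
rewrite -bigcup_seq; exists y' => //; exists (g' * g^-1)%g.
  exists (g', g) => //; split => /=.
    by exists (l1 g') => //; exact: subset_closed_ball Wg'.
  by exists (l1 g) => //; exact: subset_closed_ball Wg.
by rewrite mulgA gh' -gh mulgK.
Qed.

Lemma integrable_gball c0 c1 b x r :
  ahlfors_regular mu gdist (hom_dim G) c0 c1 -> loc_integrable mu b ->
  mu.-integrable (qball gdist x r) (EFin \o b).
Proof.
move=> reg [mb ib]; have [K cK sub] := gball_relatively_compact x r reg.
apply: integrableS (ib _ cK) => //; first exact: compact_measurable_group.
exact: measurable_qball reg _ _.
Qed.


End StratifiedGroup.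

(** * The characterization *)

Lemma campanato_finiteP (R : realType) (G : stratifiedGroup R)
    (mu : {measure set (borel G) -> \bar R}) (rho : G -> R) (beta s : R) (b : G -> R) :
  campanato_finite rho mu beta s b <->
  exists2 K : R, 0 < K & forall x r, 0 < r ->
    (campanato_quotient mu (hom_dim G) b beta s (qball (gdist rho) x r) <= K%:E)%E.
Proof.
rewrite /campanato_finite; set S := [set _ | B in gballs rho]; split.
  move=> Sfin; exists (Num.max 1 (fine (ereal_sup S))).
    by rewrite lt_max ltr01.
  move=> x r r0; apply: (@le_trans _ _ (ereal_sup S)).
    by apply: ereal_sup_ubound; exists (gball rho x r) => //; exists x, r.
  by case: (ereal_sup S) Sfin => [t _||]//; rewrite ?leNye// lee_fin le_max lexx orbT.
move=> [K _ bound]; apply: (@le_lt_trans _ _ K%:E); last exact: ltry.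
by apply: ge_ereal_sup => _ [_ [x [r [r0 ->]]] <-]; exact: bound.
Qed.

Theorem theorem1p2 (R : realType) (G : stratifiedGroup R)
    (mu : {measure set (borel G) -> \bar R}) (rho : G -> R)
    (alpha beta : R) (b : G -> R) :
  bi_invariant_haar mu ->
  homogeneous_norm rho ->
  ball_volume rho mu ->
  0 < beta < 1 ->
  0 < alpha ->
  alpha < alpha + beta ->
  alpha + beta < (hom_dim G)%:R ->
  loc_integrable mu b ->
  let Q : R := (hom_dim G)%:R in
  [<-> in_lipschitz rho mu beta b;
       forall p q : R, 1 < p < Q / (alpha + beta) ->
         q^-1 = p^-1 - (alpha + beta) / Q ->
         bounded_Lp_Lq mu p q (maximal_commutator rho mu alpha b);
       exists p q : R, [/\ 1 < p < Q / (alpha + beta),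
         q^-1 = p^-1 - (alpha + beta) / Q &
         bounded_Lp_Lq mu p q (maximal_commutator rho mu alpha b)];
       exists2 s : R, 1 <= s & campanato_finite rho mu beta s b;
       forall s : R, 1 <= s -> campanato_finite rho mu beta s b].
Proof.
move=> haar hnorm [c1 c10 vol] /andP[beta0 _] alpha0 _ abQ locb Q.
have [c0 c01 tri] := hnorm_quasi_triangle hnorm.
have ab0 : 0 < alpha + beta by rewrite addr_gt0.
have Q0 : 0 < Q := lt_trans ab0 abQ.
have reg : ahlfors_regular mu (gdist rho) (hom_dim G) c0 c1.
  by apply: gdist_regular => //; rewrite -(ltr0n R).
have [z zdense] := gdist_dense hnorm.
have mb : measurable_fun [set: borel G] (b : borel G -> R) := locb.1.
have ib w r := integrable_gball haar hnorm w r reg locb.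
have campanato_lipschitz s : 1 <= s -> campanato_finite rho mu beta s b ->
    in_lipschitz rho mu beta b.
  move=> s1 /campanato_finiteP[K K0 quo].
  pose D := 2 * K * c1 `^ (beta / (hom_dim G)%:R).
  have D0 : 0 < D by rewrite !mulr_gt0// powR_gt0.
  have osc w r r0 := campanato_osc reg mb s1 K0 r0 (quo w r r0).
  exact: (lipschitz_representative reg mb ib beta0 D0 osc zdense).
have lipschitz_campanato_all : in_lipschitz rho mu beta b ->
    forall s, 1 <= s -> campanato_finite rho mu beta s b.
  move=> [b' [L L0 lip] bb'] s s1; apply/campanato_finiteP.
  exists (L * (2 * c0) `^ beta * c1^-1 `^ (beta / (hom_dim G)%:R)).
    have c00 : 0 < c0 := lt_le_trans ltr01 c01.
    by rewrite mulr_gt0 ?powR_gt0 ?invr_gt0// mulr_gt0// powR_gt0// mulr_gt0.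
  by move=> x r r0; exact: (lipschitz_campanato reg mb ib L0 beta0 lip bb').
tfae.
- move=> [b' [L L0 lip] bb'] p q pQ qE.
  exact: (commutator_Lp_Lq reg L0 beta0 mb lip bb' zdense alpha0 pQ qE).
- move=> bound; pose p := (1 + Q / (alpha + beta)) / 2.
  have Qab : 1 < Q / (alpha + beta) by rewrite ltr_pdivlMr// mul1r.
  have pQ : 1 < p < Q / (alpha + beta) by rewrite /p; apply/andP; split; lra.
  by exists p, (p^-1 - (alpha + beta) / Q)^-1; split;
     rewrite ?invrK//; apply: bound; rewrite ?invrK.
- move=> [p [q [/andP[p1 pQ] qE [C C0 bound]]]].
  have p0 : 0 < p := lt_trans ltr01 p1.
  have q0 : 0 < q.
    rewrite -invr_gt0 qE subr_gt0 -[ltRHS]mul1r ltr_pdivlMr//.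
    by rewrite mulrAC ltr_pdivrMr// mul1r mulrC -ltr_pdivlMr.
  exists q.
    rewrite -invf_le1// qE.
    rewrite lerBlDr (le_trans (_ : p^-1 <= 1))//; first by rewrite invf_le1// ltW.
    by rewrite lerDl ltW// divr_gt0.
  apply/campanato_finiteP; exists C => // x r r0.
  have := @commutator_campanato _ _ _ _ _ _ _ _ reg _ mb ib
    alpha beta p q C x r r0 p0 q0 C0 qE.
  by apply; exact: bound.
- by move=> [s s1 fin]; apply: lipschitz_campanato_all; exact: campanato_lipschitz fin.
- by move=> all_fin; apply: (campanato_lipschitz 1) => //; exact: all_fin.
Qed.
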